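(* In the continuous setting described in the context, let $r$ be a positive integer with $\sigma_r>0$. Then $$\text{(a)}\quad \sum_{j=1}^{m}\|Lw_j-L\Pi_r^Xw_j\|^2_{L^2(\mathcal{O};Y)}=\sum_{k>r}\sigma_k^2\|L\varphi_k\|_Y^2,$$ $$\text{(b)}\quad \sum_{j=1}^{m}\|Lw_j-\Pi_r^YLw_j\|^2_{L^2(\mathcal{O};Y)}=\sum_{k>r}\sigma_k^2\|L\varphi_k-\Pi_r^YL\varphi_k\|_Y^2.$$ Also, if $L$ is invertible and either $s_X<\infty$, or $L^{-1}\Pi_r^YLKf=\sum_{j=1}^m\int_{\mathcal{O}}f_j(t)\,L^{-1}\Pi_r^YLw_j(t)\,dt$ for all $f\in S$, then $$\text{(c)}\quad \sum_{j=1}^{m}\|w_j-L^{-1}\Pi_r^YLw_j\|^2_{L^2(\mathcal{O};X)}=\sum_{k>r}\sigma_k^2\|\varphi_k-L^{-1}\Pi_r^YL\varphi_k\|_X^2.$$ In the case $s_X=\infty$, the following convergence results hold. (i) The error in (a) tends to zero as $r\to\infty$. (ii) If $\{\Pi_r^Y\}$ is uniformly bounded in operator norm, then the error in (b) tends to zero as $r\to\infty$. (iii) If the assumptions for (c) hold, $L^{-1}$ is bounded, and $\{\Pi_r^Y\}$ is uniformly bounded in operator norm, then the error in (c) tends to zero as $r\to\infty$. (iv) If the assumptions for (c) hold and $\{L^{-1}\Pi_r^YL\}$ is uniformly bounded in operator norm, then the error in (c) tends to zero as $r\to\infty$.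
   Context: Scalars are $\mathbb{K}=\mathbb{R}$ or $\mathbb{C}$; inner products are linear in the first argument. $X,Y$ are separable Hilbert spaces and $L:\mathcal{D}(L)\subset X\to Y$ is a linear operator, possibly unbounded. A ''bounded'' operator is by convention defined on the whole space. ''Invertible'' means injective, with $L^{-1}:\mathcal{D}(L^{-1})=\mathcal{R}(L)\subset Y\to X$; thus ''$L^{-1}$ bounded'' means $\mathcal{R}(L)=Y$ and $L^{-1}:Y\to X$ is bounded. Continuous setting: $\mathcal{O}\subset\mathbb{R}^d$ is open, $m\ge1$, $S=L^2(\mathcal{O};\mathbb{K}^m)$, and the data is $\{w_j\}_{j=1}^m\subset L^2(\mathcal{O};X)$ (Bochner space). The POD operator $K:S\to X$ is $Kf=\sum_{j=1}^m\int_{\mathcal{O}}f_j(t)w_j(t)\,dt$. Standing assumption: $w_j(t)\in\mathcal{D}(L)$ for a.e. $t$, $Lw_j\in L^2(\mathcal{O};Y)$ for each $j$, and for all $f\in S$ one has $Kf\in\mathcal{D}(L)$ and $LKf=\sum_{j=1}^m\int_{\mathcal{O}}f_j(t)Lw_j(t)\,dt$. $K$ is compact with singular value decomposition $Kf=\sum_{k\ge1}\sigma_k(f,f_k)_S\varphi_k$, where $\sigma_1\ge\sigma_2\ge\dots\ge0$ and $\{f_k\}\subset S$, $\{\varphi_k\}\subset X$ are orthonormal singular vectors ($Kf_k=\sigma_k\varphi_k$, $K^*\varphi_k=\sigma_kf_k$ when $\sigma_k>0$). $s_X=\mathrm{rank}(K)\in\mathbb{N}\cup\{\infty\}$, so $\sigma_k>0$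 exactly for $k\le s_X$, and then $\varphi_k\in\mathcal{D}(L)$. In sums over $k>r$, terms with $\sigma_k=0$ are taken to be zero. For $r$ with $\sigma_r>0$: $X_r=\mathrm{span}\{\varphi_k\}_{k=1}^r\subset\mathcal{D}(L)$; $\Pi_r^X:X\to X$ is the orthogonal projection onto $X_r$; $Y_r=LX_r$; $\Pi_r^Y:Y\to Y$ is a bounded linear projection onto $Y_r$, not necessarily orthogonal. A family $\{T_r\}$ is uniformly bounded in operator norm if $\|T_r\|\le C$ for all $r$ with $C$ independent of $r$. The operator $L^{-1}\Pi_r^YL$ is initially defined on $\mathcal{D}(L)$; if $\mathcal{D}(L)\ne X$, boundedness statements about it refer to a bounded linear extension to $X$. *)

(* Defs.v *)
From HB Require Import structures.
From mathcomp Require Import all_boot all_order all_algebra.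
From mathcomp Require Import complex.
From mathcomp Require Import all_classical all_reals all_analysis.
Set Implicit Arguments. Unset Strict Implicit. Unset Printing Implicit Defensive.
Import Order.TTheory GRing.Theory Num.Theory numFieldNormedType.Exports.
Local Open Scope classical_set_scope.
Local Open Scope ring_scope.

Definition image_measure d d' (T : measurableType d) (T' : measurableType d')
  (R : realType) (mu : {measure set T -> \bar R}) (f : T -> T')
  (mf : measurable_fun setT f) : {measure set T' -> \bar R}.
Proof.
refine (pushforward mu f).
exact: mf.
Defined.

Section lebesgue_tuple.
Context {R : realType}.
Local Notation RT := (measurableTypeR R).

Definition cons_tuple n (p : RT * n.-tuple RT) : n.+1.-tuple RT :=
  [the n.+1.-tuple RT of p.1 :: p.2].

Lemma measurable_cons_tuple n : measurable_fun setT (@cons_tuple n).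
Proof. by apply: (measurable_cons (f := fst) (g := snd)). Qed.

Section step.
Variables (n : nat) (mu : {sigma_finite_measure set (n.-tuple RT) -> \bar R}).

(* Lebesgue measure on R^(n+1) from the one on R^n: image of the product with
   the Lebesgue measure of R under (x, t) |-> x :: t. *)
Definition lebesgue_cons : set (n.+1.-tuple RT) -> \bar R :=
  pushforward (lebesgue_measure \x mu)%E (@cons_tuple n).

HB.instance Definition _ := Measure.copy lebesgue_cons
  (image_measure (lebesgue_measure \x mu)%E (@measurable_cons_tuple n)).

Let leb_sigma_finite : sigma_finite setT lebesgue_cons.
Proof.
have /sigma_finiteP[F [TF ndF Foo]] :=
  sigma_finiteT (lebesgue_measure : {sigma_finite_measure set RT -> \bar R}).
have /sigma_finiteP[G [TG ndG Goo]] := sigma_finiteT mu.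
pose uncons (t : n.+1.-tuple RT) : RT * n.-tuple RT :=
  (tnth t ord0, [tuple of behead t]).
have munc : measurable_fun setT uncons.
  apply: measurable_fun_pair; first exact: measurable_tnth.
  exact: measurable_behead.
have consK p : uncons (cons_tuple p) = p.
  by case: p => x t; rewrite /uncons /cons_tuple /=; congr pair; exact/val_inj.
exists (fun k => uncons @^-1` (F k `*` G k)).
  rewrite -preimage_bigcup (_ : \bigcup_k _ = setT) ?preimage_setT//.
  rewrite -subTset => -[x t] _.
  have [[i _ Fi] [j _ Gj]] : (\bigcup_i F i) x /\ (\bigcup_j G j) t.
    by rewrite -TF -TG.
  exists (maxn i j) => //; split.
    by move: x Fi; exact/subsetPset/ndF/leq_maxl.
  by move: t Gj; exact/subsetPset/ndG/leq_maxr.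
move=> k; have [mF Fk] := Foo k; have [mG Gk] := Goo k; split.
  by rewrite -[X in measurable X]setTI; apply: munc => //; exact: measurableX.
rewrite /lebesgue_cons /pushforward -comp_preimage.
rewrite (_ : uncons \o _ = id); last by apply/funext => p /=; rewrite consK.
by rewrite preimage_id product_measure1E// lte_mul_pinfty// ge0_fin_numE.
Qed.

HB.instance Definition _ := Measure_isSigmaFinite.Build _ _ _ lebesgue_cons
  leb_sigma_finite.

End step.

Fixpoint lebesgue_tuple n : {sigma_finite_measure set (n.-tuple RT) -> \bar R} :=
  if n is n'.+1 then lebesgue_cons (lebesgue_tuple n')
  else dirac ([tuple] : 0.-tuple RT).

End lebesgue_tuple.

(* R^d with its Borel sigma-algebra *)
Definition euclid (R : realType) d := g_sigma_algebraType (@open 'rV[R]_d).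

Definition row_of_tuple (R : realType) d (t : d.-tuple (measurableTypeR R)) :
  euclid R d := \row_i tnth t i.

Lemma measurable_row_of_tuple (R : realType) d :
  measurable_fun setT (@row_of_tuple R d).
Proof.
apply: (measurability (@open 'rV[R]_d : set (set (euclid R d)))) => // _ [U oU <-].
rewrite setTI.
pose itv (c : rat) (q : rat) : set (measurableTypeR R) :=
  `](ratr c - ratr q), (ratr c + ratr q)[%classic.
pose box (p : 'rV[rat]_d * rat) : set 'rV[R]_d :=
  [set v | forall i, itv (p.1 ord0 i) p.2 (v ord0 i)].
have itvE c q x : itv c q x = (`|x - ratr c| < ratr q) :> Prop.
  by rewrite /itv /= in_itv /= ltr_distl.
have mbox p : measurable (@row_of_tuple R d @^-1` box p).
  rewrite (_ : _ @^-1` _ = \bigcap_(i in [set: 'I_d])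
      (fun t => @tnth d (measurableTypeR R) t i) @^-1` itv (p.1 ord0 i) p.2).
    apply: fin_bigcap_measurable; first exact: finite_finset.
    move=> i _; rewrite -[X in measurable X]setTI.
    by apply: measurable_tnth => //; exact: measurable_itv.
  rewrite predeqE => t; split=> [bt i _|bt i].
    by have := bt i; rewrite /row_of_tuple mxE.
  by have := bt i Logic.I; rewrite /row_of_tuple mxE.
rewrite (_ : U = \bigcup_p (if `[< box p `<=` U >] then box p else set0)).
  rewrite preimage_bigcup; apply: countable_bigcupT_measurable => // p.
  by case: asboolP => _; [exact: mbox|rewrite preimage_set0].
rewrite predeqE => v; split=> [Uv|[p _]]; last first.
  by case: asboolP => // + bv; apply.
have /nbhs_ballP[e /= e0 vU] : nbhs v U by exact: open_nbhs_nbhs.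
have [q /[!in_itv]/= /andP[q0 qe]] : exists q : rat, ratr q \in `]0, e / 2[%R.
  by apply: rat_in_itvoo; rewrite divr_gt0.
have /choice[c cE] : forall i, exists c : rat, `|v ord0 i - ratr c| < ratr q.
  move=> i.
  have [c /[!in_itv]/= /andP[c1 c2]] : exists c : rat,
      ratr c \in `](v ord0 i - ratr q), (v ord0 i + ratr q)[%R.
    by apply: rat_in_itvoo; rewrite ltrD2l gtrN.
  by exists c; rewrite distrC ltr_distl c1 c2.
exists ((\row_i c i), q) => //.
case: asboolP => [_|]; first by move=> i /=; rewrite itvE mxE.
case=> x bx; apply: vU.
split=> // i j; rewrite (ord1 i).
have := bx j; rewrite /= itvE mxE => xj.
rewrite /ball /=.
rewrite (le_lt_trans (ler_distD (ratr (c j)) _ _))//.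
rewrite (splitr e) ltrD//; first exact: lt_trans (cE j) qe.
by rewrite distrC (lt_trans xj qe).
Qed.

Definition lebesgue_euclid (R : realType) d :
    {measure set (euclid R d) -> \bar R} :=
  image_measure (lebesgue_tuple d) (@measurable_row_of_tuple R d).

Lemma measurable_open_euclid (R : realType) d (O : set 'rV[R]_d) :
  open O -> measurable (O : set (euclid R d)).
Proof. exact: sub_sigma_algebra. Qed.

Definition lebesgue_on (R : realType) d (O : set 'rV[R]_d) (oO : open O) :
    {measure set (euclid R d) -> \bar R} :=
  mrestr (@lebesgue_euclid R d) (measurable_open_euclid oO).

Variant scalar_kind := RealScalars | ComplexScalars.

Definition scalars (R : realType) (s : scalar_kind) : numFieldType :=
  match s with RealScalars => R | ComplexScalars => R[i] end.

Definition re (R : realType) (s : scalar_kind) : scalars R s -> R :=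
  match s with RealScalars => id | ComplexScalars => @complex.Re R end.

Definition scalar_conj (R : realType) (s : scalar_kind) :
    scalars R s -> scalars R s :=
  match s with RealScalars => id | ComplexScalars => @conjc R end.

Definition of_real (R : realType) (s : scalar_kind) : R -> scalars R s :=
  match s with RealScalars => id | ComplexScalars => fun x => (x%:C)%C end.
Arguments of_real {R} s x.

(* The norm of a normed module over K takes its values in K. *)
Definition rnorm (R : realType) (s : scalar_kind)
  (V : normedModType (scalars R s)) (v : V) : R := re `|v|.

(* [dotE] makes the norm the one induced by the inner product, which is linear
   in its first argument and conjugate-linear in the second. *)
Record sep_hilbert (R : realType) (s : scalar_kind) := SepHilbert {
  hilbert_carrier :> completeNormedModType (scalars R s);
  dotH : {dot hilbert_carrier for @scalar_conj R s};
  dotE : forall x, dotH x x = `|x| ^+ 2;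
  separableH : exists2 D : set hilbert_carrier, countable D & dense D
}.
Arguments dotH {R s} _.

Section bochner.
Context {R : realType} {s : scalar_kind} {d : measure_display}
  {T : measurableType d} (mu : {measure set T -> \bar R}).
Local Notation K := (scalars R s).

Section vector_valued.
Context {V : normedModType K}.
Implicit Types (f g : T -> V).

Definition simple_fun f := [/\ finite_set (range f),
  forall v, measurable (f @^-1` [set v]) &
  forall v, v != 0 -> (mu (f @^-1` [set v]) < +oo)%E].

Definition simple_integral f : V :=
  \sum_(v \in range f) of_real s (fine (mu (f @^-1` [set v]))) *: v.

(* [simple_fun] only allows supports of finite measure; this loses nothing for
   the sigma-finite measures considered here. *)
Definition strongly_measurable f := exists2 g : nat -> T -> V,
  forall n, simple_fun (g n) &
    \forall t \ae mu, (fun n => g n t) @ \oo --> f t.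

(* Without strong measurability of f the integrals below would only be lower
   integrals. *)
Definition is_bochner f (x : V) := strongly_measurable f /\
  exists g : nat -> T -> V, [/\ forall n, simple_fun (g n),
    (\int[mu]_t (rnorm (f t - g n t))%:E)%E @[n --> \oo] --> 0%E &
    simple_integral (g n) @[n --> \oo] --> x].

(* 0 when f is not Bochner integrable *)
Definition bochner f : V := xget 0 [set x | is_bochner f x].

Definition L2norm f : \bar R := (Lnorm mu 2%:E (fun t => (rnorm (f t))%:E))%E.

Definition inL2 f := strongly_measurable f /\ (L2norm f < +oo)%E.

Definition sum_sqr_L2norm m (g : 'I_m -> T -> V) : \bar R :=
  (\sum_(j < m) L2norm (g j) ^+ 2)%E.

End vector_valued.

(* Elements of L^2(T; K^m) are represented by functions, through their
   components; two functions that agree a.e. represent the same element. *)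
Definition inS m (f : 'I_m -> T -> K) := forall j, inL2 (f j : T -> K^o).

Definition dotS m (f g : 'I_m -> T -> K) : K :=
  \sum_(j < m) bochner (fun t => f j t * scalar_conj (g j t) : K^o).

Definition pod_op (V : normedModType K) m (w : 'I_m -> T -> V)
    (f : 'I_m -> T -> K) : V :=
  \sum_(j < m) bochner (fun t => f j t *: w j t).

End bochner.

Section operators.
Context {R : realType} {s : scalar_kind}.
Local Notation K := (scalars R s).

(* The values of [linop_fun] outside [dom] are irrelevant. *)
Record linop (X Y : lmodType K) := LinOp {
  dom : set X;
  linop_fun :> X -> Y;
  dom0 : dom 0;
  dom_linear : forall (a : K) x y, dom x -> dom y -> dom (a *: x + y);
  linop_linear : forall (a : K) x y, dom x -> dom y ->
    linop_fun (a *: x + y) = a *: linop_fun x + linop_fun y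
}.

Definition invertible (X Y : lmodType K) (L : linop X Y) :=
  forall x y, dom L x -> dom L y -> L x = L y -> x = y.

(* The inverse on the range of L; 0 elsewhere. *)
Definition linop_inv (X Y : lmodType K) (L : linop X Y) (y : Y) : X :=
  xget 0 [set x | dom L x /\ L x = y].

Definition opnorm_le (X Y : normedModType K) (A : X -> Y) (C : R) :=
  forall x, rnorm (A x) <= C * rnorm x.

Definition bounded_inverse (X Y : normedModType K) (L : linop X Y) :=
  L @` dom L = setT /\ exists C, opnorm_le (linop_inv L) C.

Definition span_upto (X : lmodType K) (phi : nat -> X) (r : nat) : set X :=
  [set x | exists c : nat -> K, x = \sum_(1 <= k < r.+1) c k *: phi k].

Definition is_bounded_proj (Y : normedModType K) (P : {linear Y -> Y})
    (A : set Y) :=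
  [/\ exists C, opnorm_le P C, range P = A & forall y, P (P y) = P y].

Definition orth_proj (X : sep_hilbert R s) (A : set X) (x : X) : X :=
  xget 0 [set p | A p /\ forall v, A v -> dotH X (x - p) v = 0].

End operators.

Section pod.
Context {R : realType} {s : scalar_kind} {d : measure_display}
  {T : measurableType d} (mu : {measure set T -> \bar R})
  {X Y : sep_hilbert R s} (L : linop X Y) {m : nat} (w : 'I_m -> T -> X).
Local Notation K := (scalars R s).

Definition pod_standing_assumption :=
  [/\ forall j, \forall t \ae mu, dom L (w j t),
      forall j, inL2 mu (fun t => L (w j t)) &
      forall f, inS mu f -> dom L (pod_op mu w f) /\
        L (pod_op mu w f) = pod_op mu (fun j t => L (w j t)) f].

(* Sequences are indexed from 1 (the values at 0 are irrelevant) and a finite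
   family of singular values is padded with zeros; singular vectors are only
   constrained at the indices where the singular value is nonzero.  The
   equation for the adjoint K^* is (Kg, phi_k) = (g, sigma_k f_k). *)
Definition is_svd (sigma : nat -> R) (f : nat -> 'I_m -> T -> K)
    (phi : nat -> X) :=
  [/\ forall k, (0 < k)%N -> 0 <= sigma k.+1 <= sigma k,
      forall k, (0 < k)%N -> 0 < sigma k ->
        [/\ inS mu (f k), pod_op mu w (f k) = of_real s (sigma k) *: phi k &
          forall g, inS mu g -> dotH X (pod_op mu w g) (phi k) =
            dotS mu g (fun j t => of_real s (sigma k) * f k j t)],
      forall k l, (0 < k)%N -> (0 < l)%N -> 0 < sigma k -> 0 < sigma l ->
        dotS mu (f k) (f l) = (k == l)%:R /\
        dotH X (phi k) (phi l) = (k == l)%:R &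
      forall g, inS mu g ->
        \sum_(1 <= k < n.+1) (of_real s (sigma k) * dotS mu g (f k)) *: phi k
          @[n --> \oo] --> pod_op mu w g].

Definition finite_rank := exists n (e : nat -> X),
  forall f, inS mu f -> span_upto e n (pod_op mu w f).

Variables (phi : nat -> X) (PiY : nat -> {linear Y -> Y}) (r : nat).

Definition residualA j t : Y :=
  L (w j t) - L (orth_proj (span_upto phi r) (w j t)).
Definition residualB j t : Y := L (w j t) - PiY r (L (w j t)).
Definition residualC j t : X := w j t - linop_inv L (PiY r (L (w j t))).

Definition commutation_assumption := forall f, inS mu f ->
  linop_inv L (PiY r (L (pod_op mu w f))) =
  pod_op mu (fun j t => linop_inv L (PiY r (L (w j t)))) f.

End pod.

(* Main.v *)
Require Import Defs.
From HB Require Import structures.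
From mathcomp Require Import all_boot all_order all_algebra.
From mathcomp Require Import complex.
From mathcomp Require Import all_classical all_reals all_analysis.
From mathcomp Require Import measurable_realfun.
From mathcomp Require Import lra ring.

(** Each of the three residuals has the form [g_j = M (L w_j) + N w_j] with
    bounded linear maps [M : Y -> V] and [N : X -> V]: in (a), [M] is the
    identity and [N = - L Pi_r], which is bounded because it has finite rank;
    in (b), [M = 1 - PiY_r] and [N = 0]; in (c), [M = - L^-1 PiY_r] and [N] is
    the identity, where [L^-1 PiY_r] is bounded because [L^-1] is only applied
    on the finite-dimensional space [L X_r] ([inv_proj_bounded]). Bounded maps
    commute with the Bochner integral, so the POD operator of [g] is
    [G = M L K + N K]. Hence [G f_k = sigma_k (M L phi_k + N phi_k)], and [G]
    vanishes wherever [K] does, in particular on every [h] orthogonal to all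
    the [f_k].

    The three formulas are therefore cases of the Hilbert-Schmidt identity
    [sum_j |g_j|^2 = sum_k |G f_k|^2], valid as soon as [G] vanishes on the
    orthogonal complement of the [f_k] ([pod_sum_sqr_cvg]). To prove it, put
    [u_n = sum_(k < n) conj(f_k) G f_k] in [L^2(T; V)^m]. The summands are
    orthogonal and [|g - u_n|^2 = |g|^2 - sum_(k < n) |G f_k|^2], so [u_n]
    converges to some [u] ([riesz_fischer]), and the point is that [z = g - u]
    is zero. Let [v] be in [V] and [h_j = (v, z_j)]. By construction [z] is
    orthogonal to all [conj(f_k) v], which says that [h] is orthogonal to all
    [f_k]. Then [G h = 0], so [g] is orthogonal to [conj(h) v]; so are the
    [u_n], hence [u]. Thus [0 = (z, conj(h) v) = sum_j int |(z_j, v)|^2], and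
    [z_j(t)] is orthogonal to [v] for almost every [t]; as [V] is separable,
    [z = 0]. The limit [u] has to be taken in [L^2]: as [L] need not be closed,
    the limits of partial sums in [X] and [Y] do not determine [G] from the
    [G f_k].

    In the formulas the terms of index at most [r] vanish because the residual
    annihilates [X_r]. The convergence statements follow by bounding the terms
    of index [k > r], uniformly in [r], by a multiple of
    [sigma_k^2 |L phi_k|^2] or of [sigma_k^2 |phi_k|^2]; both series converge,
    by the same identity applied with [(M, N) = (1, 0)] and [(M, N) = (0, 1)].

    Two technical choices run through the text. The norm of a strongly
    measurable function is in general only almost everywhere equal to a
    measurable function, so real integrals are handled up to null sets
    ([ae_integrable]). And a Bochner integral is only used through
    [l (int f) = int (l o f)] for bounded real-linear forms [l]
    ([bochner_form]): real inner products separate points, so these equations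
    determine it. *)

Set Implicit Arguments.
Unset Strict Implicit.
Unset Printing Implicit Defensive.
Import Order.TTheory GRing.Theory Num.Theory numFieldNormedType.Exports.
Local Open Scope classical_set_scope.
Local Open Scope ring_scope.

(** * Real and complex scalars *)

Section scalar_theory.
Context {R : realType} {s : scalar_kind}.
Local Notation K := (scalars R s).
Local Notation re := (@re R s).
Local Notation conj := (@scalar_conj R s).
Local Notation ofR := (@of_real R s).

Lemma re_ofR a : re (ofR a) = a.
Proof. by case: s a. Qed.

Lemma reD (x y : K) : re (x + y) = re x + re y.
Proof. by case: s x y => //= -[a b] [c d]. Qed.

Lemma re0 : re 0 = 0.
Proof. by case: s. Qed.

Lemma re_ofRM a (x : K) : re (ofR a * x) = a * re x.
Proof. by case: s x => //= -[b c] /=; rewrite mul0r subr0. Qed.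

Lemma conjD (x y : K) : conj (x + y) = conj x + conj y.
Proof. by case: s x y => //= x y; rewrite rmorphD. Qed.

Lemma conjB (x y : K) : conj (x - y) = conj x - conj y.
Proof. by case: s x y => //= x y; rewrite rmorphB. Qed.

Lemma conjM (x y : K) : conj (x * y) = conj x * conj y.
Proof. by case: s x y => //= x y; rewrite rmorphM. Qed.

Lemma conj0 : conj 0 = 0.
Proof. by case: s => //=; rewrite /conjc oppr0. Qed.

Lemma conjK (x : K) : conj (conj x) = x.
Proof. by case: s x => //= x; rewrite conjcK. Qed.

Lemma conj_ofR a : conj (ofR a) = ofR a.
Proof. by case: s => //=; rewrite /conjc oppr0. Qed.

Lemma re_conj (x : K) : re (conj x) = re x.
Proof. by case: s x => //= -[]. Qed.

Lemma ofR0 : ofR 0 = 0. Proof. by case: s. Qed.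
Lemma ofR1 : ofR 1 = 1. Proof. by case: s. Qed.

Lemma ofRD a b : ofR (a + b) = ofR a + ofR b.
Proof. by case: s => //=; rewrite rmorphD. Qed.

Lemma ofRM a b : ofR (a * b) = ofR a * ofR b.
Proof. by case: s => //=; rewrite rmorphM. Qed.

Lemma ofRN a : ofR (- a) = - ofR a.
Proof. by case: s => //=; rewrite rmorphN. Qed.

Lemma ofRX a n : ofR (a ^+ n) = ofR a ^+ n.
Proof. by elim: n => [|n IH]; rewrite ?expr0 ?ofR1// !exprS ofRM IH. Qed.

Lemma ofR_ge0 a : (0 <= ofR a) = (0 <= a).
Proof. by case: s => //=; rewrite lecR. Qed.

Lemma ofR_le a b : (ofR a <= ofR b) = (a <= b).
Proof. by case: s => //=; rewrite lecR. Qed.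

Lemma ofR_lt a b : (ofR a < ofR b) = (a < b).
Proof. by case: s => //=; rewrite ltcR. Qed.

Lemma ofR_inj : injective ofR.
Proof. by move=> a b /(congr1 re); rewrite !re_ofR. Qed.

(** In the order of [R[i]] comparable numbers have equal imaginary parts, so a
    nonnegative scalar is real. *)
Lemma ge0_ofR (x : K) : 0 <= x -> x = ofR (re x).
Proof.
case: s x => /= [x|[a b]]; first by [].
by rewrite lecE/= => /andP[/eqP -> _].
Qed.

Lemma mul_conj (x : K) : x * conj x = `|x| ^+ 2.
Proof.
case: s x => /= [x|x]; first by rewrite real_normK ?num_real ?expr2.
by rewrite normCK.
Qed.

Lemma re_le_norm (x : K) : `|re x| <= re `|x|.
Proof.
case: s x => /= [x|[a b]/=]; first by [].
rewrite -[leLHS]sqrtr_sqr ler_sqrt ?lerDl ?sqr_ge0//.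
by rewrite addr_ge0 ?sqr_ge0.
Qed.

Section rnorm_theory.
Context {V : normedModType K}.
Implicit Types (x y : V).

Lemma normE x : `|x| = ofR (rnorm x).
Proof. exact: ge0_ofR. Qed.

Lemma rnorm_ge0 x : 0 <= rnorm x.
Proof. by rewrite -ofR_ge0 -normE. Qed.

Lemma rnorm0 : rnorm (0 : V) = 0.
Proof. by rewrite /rnorm normr0 re0. Qed.

Lemma rnorm_eq0 x : rnorm x = 0 -> x = 0.
Proof. by move=> x0; apply/eqP; rewrite -normr_eq0 normE x0 ofR0. Qed.

Lemma rnormN x : rnorm (- x) = rnorm x.
Proof. by rewrite /rnorm normrN. Qed.

Lemma rnormD x y : rnorm (x + y) <= rnorm x + rnorm y.
Proof. by rewrite -ofR_le ofRD -!normE ler_normD. Qed.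

Lemma rnormB x y : rnorm (x - y) <= rnorm x + rnorm y.
Proof. by rewrite -(rnormN y) rnormD. Qed.

Lemma rnormBC x y : rnorm (x - y) = rnorm (y - x).
Proof. by rewrite -rnormN opprB. Qed.

Lemma rnormZ (a : K) x : rnorm (a *: x) = re `|a| * rnorm x.
Proof. by apply: ofR_inj; rewrite ofRM -!normE normrZ -ge0_ofR. Qed.

Lemma rnormZR (a : R) x : rnorm (ofR a *: x) = `|a| * rnorm x.
Proof.
rewrite rnormZ; congr (_ * _); apply: ofR_inj; rewrite -ge0_ofR//.
case: s => //=; rewrite normc_def/= expr0n/= addr0 sqrtr_sqr//.
Qed.

(** A positive tolerance in the scalar field is a real number by [ge0_ofR], so
    that real tolerances suffice. *)
Lemma cvg_rnorm (I : Type) (F : set_system I) {FF : Filter F} (u : I -> V) l :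
  u @ F --> l <-> rnorm (u i - l) @[i --> F] --> (0 : R).
Proof.
split=> [/cvgrPdist_lt ul|/cvgrPdist_lt ul].
- apply/cvgrPdist_lt => e e0; have := ul (ofR e).
  rewrite -[X in X < ofR e -> _]ofR0 ofR_lt => /(_ e0).
  apply: filterS => i; rewrite normE ofR_lt sub0r normrN.
  by rewrite ger0_norm ?rnorm_ge0// rnormBC.
- apply/cvgrPdist_lt => e e0; have eE := ge0_ofR (ltW e0).
  have /ul : 0 < re e by move: e0;
    rewrite {1}eE -[X in X < ofR (re e) -> _]ofR0 ofR_lt.
  apply: filterS => i; rewrite sub0r normrN ger0_norm ?rnorm_ge0// => ui.
  by rewrite normE eE ofR_lt rnormBC.
Qed.

End rnorm_theory.

Lemma rnorm_mul (x y : K) :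
  rnorm (x * y : K^o) = rnorm (x : K^o) * rnorm (y : K^o).
Proof. exact: (@rnormZ (K^o) x y). Qed.

Lemma rnorm_conj (x : K) : rnorm (conj x : K^o) = rnorm (x : K^o).
Proof.
rewrite /rnorm; case: s x => //=; move=> [a b] /=; by rewrite sqrrN.
Qed.

End scalar_theory.

(** * Integration of functions measurable up to a null set *)

Section nonmeasurable_integral.
Import HBNNSimple.

(** The integral of a nonnegative function is a supremum over the simple
    functions below it, even if it is not measurable; cutting a simple function
    to the complement of a null set changes neither its integral nor the bound
    outside that null set. *)
Lemma ge0_integral_ae d (T : measurableType d) (R : realType)
    (mu : {measure set T -> \bar R}) (f g : T -> \bar R) :
  (forall t, 0 <= f t)%E -> (forall t, 0 <= g t)%E ->
    (\forall t \ae mu, f t = g t) ->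
  (\int[mu]_t f t = \int[mu]_t g t)%E.
Proof.
suff le_int (u v : T -> \bar R) : (forall t, 0 <= u t)%E ->
    (forall t, 0 <= v t)%E -> (\forall t \ae mu, u t = v t) ->
    (\int[mu]_t u t <= \int[mu]_t v t)%E.
  move=> f0 g0 fg; apply/eqP; rewrite eq_le !le_int//.
  by apply: filterS fg => t ->.
move=> u0 v0 [N [mN muN uvN]].
rewrite (ge0_integralTE mu u0) (ge0_integralTE mu v0).
apply: ge_ereal_sup => _ [h /= hu <-].
pose k := proj_nnsfun h (measurableC mN).
have kE t : k t = h t * \1_(~` N) t by [].
apply: ereal_sup_ubound; exists k => /=.
  move=> t; suff : ((k t)%:E <= v t)%E by []; rewrite kE indicE;
    have [tN|tN] := boolP (t \in ~` N).
    rewrite mulr1; suff <- : u t = v t by exact: hu.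
    by apply: contrapT => /uvN; move: tN; rewrite inE.
  by rewrite mulr0 v0.
rewrite -!integralT_nnsfun; apply: ge0_ae_eq_integral => //.
- exact/measurable_EFinP.
- exact/measurable_EFinP.
- by move=> t _; rewrite lee_fin.
- by move=> t _; rewrite lee_fin.
exists N; split => // t /= /not_implyP[_] kh.
apply: contrapT => tN; apply: kh; suff : (h t)%:E = (k t)%:E by [].
by rewrite kE indicE (mem_set (tN : (~` N) t)) mulr1.
Qed.

End nonmeasurable_integral.

Section ae_integration.
Context {d : measure_display} {T : measurableType d} {R : realType}
  (mu : {measure set T -> \bar R}).

Lemma integral_ae (f g : T -> \bar R) : (\forall t \ae mu, f t = g t) ->
  (\int[mu]_t f t = \int[mu]_t g t)%E.
Proof.
move=> fg; have /ae_eq_funeposneg[fgp fgn] : ae_eq mu setT f g.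
  by apply: filterS fg.
rewrite integralE [RHS]integralE; congr (_ - _)%E; apply: ge0_integral_ae => //.
  by apply: filterS fgp => t; exact.
by apply: filterS fgn => t; exact.
Qed.

(** Composing an almost everywhere limit of simple functions with a continuous
    map yields functions of this kind only, since the measure may be
    incomplete. *)
Definition ae_measurable (h : T -> R) :=
  exists2 h', measurable_fun setT h' & \forall t \ae mu, h t = h' t.

Definition ae_integrable (h : T -> R) :=
  exists2 h', mu.-integrable setT (EFin \o h') & \forall t \ae mu, h t = h' t.

Local Notation I h := (Rintegral mu setT h).

Lemma Rintegral_ae (f g : T -> R) : (\forall t \ae mu, f t = g t) -> I f = I g.
Proof.
by move=> fg; congr fine; apply: integral_ae; apply: filterS fg => t ->.
Qed.

Lemma ae_integrable_measurable h : ae_integrable h -> ae_measurable h.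
Proof.
by case=> h' /measurable_int/measurable_EFinP mh hh'; exists h'.
Qed.

Lemma ae_integral_EFin h : ae_integrable h ->
  (\int[mu]_t (h t)%:E = (I h)%:E)%E.
Proof.
move=> [h' ih hh']; rewrite (Rintegral_ae hh') (@integral_ae _ (EFin \o h')).
  by rewrite fineK//; exact: integrable_fin_num.
by apply: filterS hh' => t ->.
Qed.

Lemma eq_ae_integrable h h' : (\forall t \ae mu, h t = h' t) ->
  ae_integrable h -> ae_integrable h'.
Proof.
move=> hh' [g ig hg]; exists g => //.
by apply: filterS2 hh' hg => t -> ->.
Qed.

Lemma eq_ae_measurable h h' : (\forall t \ae mu, h t = h' t) ->
  ae_measurable h -> ae_measurable h'.
Proof.
move=> hh' [g ig hg]; exists g => //.
by apply: filterS2 hh' hg => t -> ->.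
Qed.

Lemma ae_integrable0 : ae_integrable (fun=> 0).
Proof. by exists (fun=> 0); [exact: integrable0|exact: nearW]. Qed.

Lemma ae_integrableD f g : ae_integrable f -> ae_integrable g ->
  ae_integrable (fun t => f t + g t).
Proof.
move=> [f' if' ff'] [g' ig' gg']; exists (fun t => f' t + g' t).
  exact: (integrableD measurableT if' ig').
by apply: filterS2 ff' gg' => t -> ->.
Qed.

Lemma ae_integrableZ a f : ae_integrable f -> ae_integrable (fun t => a * f t).
Proof.
move=> [f' if' ff']; exists (fun t => a * f' t).
  exact: (integrableZl measurableT _ if').
by apply: filterS ff' => t ->.
Qed.

Lemma ae_integrableB f g : ae_integrable f -> ae_integrable g ->
  ae_integrable (fun t => f t - g t).
Proof.
move=> if' ig'; have := ae_integrableD if' (ae_integrableZ (-1) ig').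
by apply: eq_ae_integrable; apply: nearW => t; rewrite mulN1r.
Qed.

Lemma Rintegral_aeD f g : ae_integrable f -> ae_integrable g ->
  I (fun t => f t + g t) = I f + I g.
Proof.
move=> [f' if' ff'] [g' ig' gg']; rewrite (Rintegral_ae ff') (Rintegral_ae gg').
rewrite -RintegralD//; apply: Rintegral_ae.
by apply: filterS2 ff' gg' => t -> ->.
Qed.

Lemma Rintegral_aeZ a f : ae_integrable f -> I (fun t => a * f t) = a * I f.
Proof.
move=> [f' if' ff']; rewrite (Rintegral_ae ff') -RintegralZl//.
by apply: Rintegral_ae; apply: filterS ff' => t ->.
Qed.

Lemma Rintegral_aeB f g : ae_integrable f -> ae_integrable g ->
  I (fun t => f t - g t) = I f - I g.
Proof.
move=> if' ig'; rewrite -[- I g]mulN1r -Rintegral_aeZ// -Rintegral_aeD//;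
  last exact: ae_integrableZ.
by apply: eq_Rintegral => t _; rewrite mulN1r.
Qed.

Lemma Rintegral_ae_sum (J : Type) (r : seq J) (P : pred J) (f : J -> T -> R) :
  (forall j, P j -> ae_integrable (f j)) ->
    ae_integrable (fun t => \sum_(j <- r | P j) f j t) /\
  I (fun t => \sum_(j <- r | P j) f j t) = \sum_(j <- r | P j) I (f j).
Proof.
move=> fi; elim: r => [|j r [IH1 IH2]].
  split; first by under eq_fun do rewrite big_nil; exact: ae_integrable0.
  rewrite big_nil -[RHS](mul0r (I (fun=> 0))) -Rintegral_aeZ;
    last exact: ae_integrable0.
  by apply: eq_Rintegral => t _; rewrite big_nil mulr0.
under eq_fun do rewrite big_cons; rewrite big_cons.
by case: ifPn => // Pj; split; [apply: ae_integrableD => //; exact: fi|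
  rewrite Rintegral_aeD ?IH2//; exact: fi].
Qed.

Lemma ae_integrable_dom (h F : T -> R) : ae_measurable h -> ae_integrable F ->
  (\forall t \ae mu, `|h t| <= F t) -> ae_integrable h.
Proof.
move=> [h' mh hh'] [F' iF FF'] hF.
have mF' : measurable_fun setT F' by move/measurable_int/measurable_EFinP : iF.
pose A := [set t | `|h' t| <= F' t].
have mA : measurable A.
  rewrite -[A]setTI; apply: measurable_fun_le => //.
  exact: measurableT_comp.
exists (fun t => h' t * \1_A t).
  apply: (le_integrable measurableT _ _ iF).
    apply/measurable_EFinP; apply: measurable_funM => //.
  move=> t _; rewrite /= lee_fin normrM indicE; have [tA|tA] := boolP (t \in A).
    rewrite normr1 mulr1 (le_trans _ (ler_norm _))//.
    by move: tA; rewrite inE.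
  by rewrite normr0 mulr0.
apply: filterS3 hh' FF' hF => t ht Ft hF; rewrite indicE mem_set ?mulr1//.
by rewrite /A/= -ht -Ft.
Qed.

Lemma ae_integrable_norm h : ae_integrable h -> ae_integrable (fun t => `|h t|).
Proof.
move=> [h' ih hh']; exists (fun t => `|h' t|); first exact: integrable_norm.
by apply: filterS hh' => t ->.
Qed.

Lemma Rintegral_ae_le f g : ae_integrable f -> ae_integrable g ->
  (\forall t \ae mu, f t <= g t) ->
  I f <= I g.
Proof.
move=> if' ig' fg; have ih := ae_integrableB ig' if'.
rewrite -subr_ge0 -Rintegral_aeB//;
  rewrite (@Rintegral_ae _ (fun t => `|g t - f t|)).
  by apply: Rintegral_ge0 => t _.
by apply: filterS fg => t fgt; rewrite ger0_norm// subr_ge0.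
Qed.

Lemma Rintegral_ge0T f : (forall t, 0 <= f t) -> 0 <= I f.
Proof. by move=> f0; apply: Rintegral_ge0. Qed.

Lemma Rintegral_ae_abs f : ae_integrable f -> `|I f| <= I (fun t => `|f t|).
Proof.
move=> if'; have iN := ae_integrableZ (-1) if';
  have ia := ae_integrable_norm if'.
rewrite ler_norml -[- I _]mulN1r -Rintegral_aeZ//; apply/andP; split.
  apply: Rintegral_ae_le => //; first exact: ae_integrableZ.
  by apply: nearW => t; rewrite mulN1r lerNl ler_normr lexx orbT.
by apply: Rintegral_ae_le => //; apply: nearW => t; rewrite ler_norm.
Qed.

Lemma ae_integrable_ge0 h : ae_measurable h -> (forall t, 0 <= h t) ->
  (\int[mu]_t (h t)%:E < +oo)%E -> ae_integrable h.
Proof.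
move=> [h' mh hh'] h0 hoo; exists h' => //.
apply/integrableP; split; first exact/measurable_EFinP.
rewrite (@integral_ae _ (fun t => (h t)%:E))//.
by apply: filterS hh' => t ht; rewrite /= -ht ger0_norm.
Qed.

(** A single null set carries all the exceptions; multiplying by the indicator
    function of its complement turns convergence almost everywhere into
    convergence everywhere, which the convergence theorems for measurable
    functions can use. *)
Lemma ae_measurable_seq (h_ : nat -> T -> R) (h : T -> R) :
  (forall n, ae_measurable (h_ n)) ->
  (\forall t \ae mu, h_ ^~ t @ \oo --> h t) ->
  exists k_ : nat -> T -> R, exists k : T -> R,
  [/\ forall n, measurable_fun setT (k_ n), measurable_fun setT k,
    forall n, \forall t \ae mu, h_ n t = k_ n t,
    \forall t \ae mu, h t = k t & forall t, k_ ^~ t @ \oo --> k t].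
Proof.
move=> /(_ _)/cid2-/all_sig2[g mg hg] hcvg.
have [N [mN N0 NP]] := filterI hcvg (ae_foralln hg).
have NP' t : ~ N t -> h_ ^~ t @ \oo --> h t /\ forall n, h_ n t = g n t.
  by move=> Nt; apply: contrapT => /NP.
have aeN : \forall t \ae mu, ~ N t.
  by exists N; split => // t /= /contrapT.
have mk n : measurable_fun setT (fun t => g n t * \1_(~` N) t).
  by apply: measurable_funM => //; apply: measurable_indic; exact: measurableC.
have kc t : (fun n => g n t * \1_(~` N) t) @ \oo --> h t * \1_(~` N) t.
  have [Nt|Nt] := pselect (N t).
    rewrite indicE memNset; last by move/(_ Nt).
    by under eq_fun do rewrite mulr0; rewrite mulr0; exact: cvg_cst.
  rewrite indicE mem_set// mulr1; under eq_fun do rewrite mulr1.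
  by have [+ gE] := NP' _ Nt; under eq_fun do rewrite gE.
exists (fun n t => g n t * \1_(~` N) t), (fun t => h t * \1_(~` N) t).
split => //.
- by apply: (measurable_fun_cvg mk) => t _; exact: kc.
- move=> n; apply: filterS aeN => t Nt.
  by rewrite indicE mem_set// mulr1 (NP' _ Nt).2.
- by apply: filterS aeN => t Nt; rewrite indicE mem_set// mulr1.
Qed.

Lemma ae_measurable_cvg (h_ : nat -> T -> R) h :
  (forall n, ae_measurable (h_ n)) ->
  (\forall t \ae mu, h_ ^~ t @ \oo --> h t) -> ae_measurable h.
Proof.
move=> mh hc; have [k_ [k [_ mk _ hk _]]] := ae_measurable_seq mh hc.
by exists k.
Qed.

Lemma ae_dominated_cvg0 (h_ : nat -> T -> R) F :
  (forall n, ae_measurable (h_ n)) -> ae_integrable F ->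
  (\forall t \ae mu, h_ ^~ t @ \oo --> (0 : R)) ->
  (forall n, \forall t \ae mu, `|h_ n t| <= F t) -> I (h_ n) @[n --> \oo] --> 0.
Proof.
move=> mh [F' iF FF'] hc hF.
have [k_ [k [mk_ mk hk_ hk kc]]] := ae_measurable_seq mh hc.
have kF : \forall t \ae mu, forall n, setT t -> (`|(k_ n t)%:E| <= (F' t)%:E)%E.
  have aek : \forall t \ae mu, forall n, `|h_ n t| <= F t /\ h_ n t = k_ n t.
    by apply: ae_foralln => n; apply: filterI; [exact: hF|exact: hk_].
  apply: filterS2 FF' aek => t Ft hkt n _.
  by rewrite lee_fin; have [+ <-] := hkt n; rewrite Ft.
have [] := @dominated_convergence _ _ _ mu _ measurableT
  (fun n t => (k_ n t)%:E) (EFin \o k) (EFin \o F').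
- by move=> n; exact/measurable_EFinP.
- exact/measurable_EFinP.
- by apply: nearW => t _; apply/fine_cvgP; split; [exact: nearW|exact: kc].
- exact: iF.
- exact: kF.
move=> _ _; rewrite [X in _ --> X](_ : _ = 0%:E); last first.
  transitivity (\int[mu]_t 0)%E; last exact: integral0.
  have aek : \forall t \ae mu, forall n, h_ n t = k_ n t by exact: ae_foralln.
  apply: integral_ae; apply: filterS2 aek hc => t hkt.
  under eq_fun do rewrite hkt.
  move=> kt0; have := cvg_lim (@Rhausdorff R) (kc t).
  by rewrite (cvg_lim (@Rhausdorff R) kt0) => k0; rewrite /= -k0.
move=> /fine_cvg /=.
rewrite (_ : _ \o _ = (fun n => I (h_ n)))//; apply/funext => n /=.
by apply/esym/Rintegral_ae.
Qed.

Lemma ae_fatou (h_ : nat -> T -> R) (h : T -> R) (C : R) :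
  (forall n, ae_integrable (h_ n)) ->
  (forall n t, 0 <= h_ n t) -> (forall t, 0 <= h t) ->
  (\forall t \ae mu, h_ ^~ t @ \oo --> h t) ->
  (forall n, I (h_ n) <= C) -> ae_integrable h /\ I h <= C.
Proof.
move=> ih h_0 h0 hc hC; have mh n := ae_integrable_measurable (ih n).
have [k_ [k [mk_ mk hk_ hk kc]]] := ae_measurable_seq mh hc.
have kc' t : (fun n => `|k_ n t|%:E) @ \oo --> `|k t|%:E.
  apply/fine_cvgP; split; first exact: nearW.
  by apply: cvg_norm; exact: kc.
have mk' n : measurable_fun setT (fun t => `|k_ n t|%:E).
  by apply/measurable_EFinP; exact: measurableT_comp.
have k_0 n t : setT t -> (0 <= `|k_ n t|%:E)%E by rewrite lee_fin.
have := fatou mu measurableT mk' k_0.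
rewrite (@integral_ae _ (fun t => (h t)%:E)); last first.
  apply: filterS hk => t ht.
  by rewrite (cvg_limn_einf_sup (kc' t)).1 -ht ger0_norm.
rewrite [X in limn_einf X](_ : _ = (fun n => (I (h_ n))%:E)); last first.
  apply/funext => n; rewrite -ae_integral_EFin//; apply: integral_ae.
  by apply: filterS (hk_ n) => t ht; rewrite /= -ht ger0_norm.
move=> hle.
have {}hle : (\int[mu]_t (h t)%:E <= C%:E)%E.
  apply: (le_trans hle); rewrite limn_einf_lim; apply: lime_le.
    exact: is_cvg_einfs.
  apply: nearW => n; apply: (le_trans (y := (I (h_ n))%:E)).
    by apply: ereal_inf_lbound; exists n => /=.
  by rewrite lee_fin.
have ihh : ae_integrable h.
  apply: ae_integrable_ge0 => //; last by rewrite (le_lt_trans hle) ?ltry.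
  exact: ae_measurable_cvg mh hc.
by split=> //; rewrite -lee_fin -ae_integral_EFin.
Qed.

(** The sum of the series has a finite integral, hence is finite almost
    everywhere. *)
Lemma ae_beppo_levi (h_ : nat -> T -> R) (C : R) :
  (forall n, ae_integrable (h_ n)) ->
  (forall n t, 0 <= h_ n t) -> (forall N, \sum_(n < N) I (h_ n) <= C) ->
  \forall t \ae mu, exists M, forall N, \sum_(n < N) h_ n t <= M.
Proof.
move=> ih h0 hC.
have /all_sig2[k ik hk] : forall n, {k : T -> R |
    mu.-integrable setT (EFin \o k) & \forall t \ae mu, h_ n t = k t}.
  by move=> n; apply: cid2; exact: ih.
have mk n : measurable_fun setT (fun t => `|k n t|%:E).
  apply/measurable_EFinP/measurableT_comp => //.
  by move/measurable_int/measurable_EFinP : (ik n).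
have k0 n t : setT t -> (0 <= `|k n t|%:E)%E by rewrite lee_fin.
have kI n : (\int[mu]_t `|k n t|%:E = (I (h_ n))%:E)%E.
  rewrite -ae_integral_EFin//; apply: integral_ae.
  by apply: filterS (hk n) => t ht; rewrite /= -ht ger0_norm.
have := integral_nneseries mu measurableT mk k0.
under eq_eseriesr do rewrite kI.
have le_C : (\sum_(n <oo) (I (h_ n))%:E <= C%:E)%E.
  apply: lime_le.
    by apply: is_cvg_nneseries => n _ _; rewrite lee_fin Rintegral_ge0T.
  by apply: nearW => N; rewrite big_mkord sumEFin lee_fin.
move=> intE.
have ik' : mu.-integrable setT (fun t => \sum_(n <oo) `|k n t|%:E)%E.
  apply/integrableP; split.
    exact: ge0_emeasurable_sum.
  rewrite (eq_integral (fun t => \sum_(n <oo) `|k n t|%:E)%E).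
    by rewrite intE (le_lt_trans le_C) ?ltry.
  by move=> t _; rewrite gee0_abs// nneseries_ge0// => n _ _; rewrite lee_fin.
have := integrable_ae measurableT ik'.
have := ae_foralln hk.
apply: filterS2 => t hkt /(_ Logic.I) fin.
exists (fine (\sum_(n <oo) `|k n t|%:E)%E) => N.
rewrite -lee_fin fineK// -sumEFin.
rewrite (eq_bigr (fun n : 'I_N => `|k n t|%:E)%E); last first.
  by move=> n _; rewrite hkt ger0_norm// -hkt.
rewrite -(big_mkord xpredT (fun n => `|k n t|%:E)%E).
by apply: nneseries_lim_ge => n _ _; rewrite lee_fin.
Qed.

Lemma Rintegral_ae_eq0 h : ae_integrable h -> (forall t, 0 <= h t) -> I h = 0 ->
  \forall t \ae mu, h t = 0.
Proof.
move=> ih h0 Ih0; have [k ik hk] := ih.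
have : (\int[mu]_t `|(k t)%:E| = 0)%E.
  rewrite (@integral_ae _ (fun t => (h t)%:E)) ?ae_integral_EFin ?Ih0//.
  by apply: filterS hk => t ht; rewrite /= -ht ger0_norm.
move/(ae_eq_integral_abs _ measurableT (measurable_int _ ik)).
by apply: filterS2 hk => t -> /(_ Logic.I) [].
Qed.

End ae_integration.

(** * Simple and strongly measurable functions *)

Lemma cvg_pow (R : realType) (u : nat -> R) (x : R) p : u @ \oo --> x ->
  (fun n => u n ^+ p) @ \oo --> x ^+ p.
Proof.
move=> ux; elim: p => [|p IH].
  by under eq_fun do rewrite expr0; exact: cvg_cst.
by under eq_fun do rewrite exprS; rewrite exprS; exact: cvgM.
Qed.

Section simple_theory.
Context {R : realType} {s : scalar_kind} {d : measure_display}
  {T : measurableType d} (mu : {measure set T -> \bar R}).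
Local Notation K := (scalars R s).
Local Notation I h := (Rintegral mu setT h).

Section two_simple.
Context {V1 V2 : normedModType K}.
Variables (g1 : T -> V1) (g2 : T -> V2).
Hypotheses (sg1 : simple_fun mu g1) (sg2 : simple_fun mu g2).

(** The set is a finite union of intersections of a level set of [g1] and one
    of [g2]. *)
Lemma simple_preimage2 (P : V1 -> V2 -> Prop) :
  measurable [set t | P (g1 t) (g2 t)].
Proof.
have [f1 m1 _] := sg1; have [f2 m2 _] := sg2.
rewrite (_ : [set t | _] = \bigcup_(p in (range g1 `*` range g2) `&`
    [set p | P p.1 p.2]) (g1 @^-1` [set p.1] `&` g2 @^-1` [set p.2])).
  apply: fin_bigcup_measurable; first exact/finite_setIl/finite_setX.
  by move=> p _; exact: measurableI.
rewrite predeqE => t; split => [Pt|[[x y] [_ /= Pxy] [/= -> ->]]//].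
by exists (g1 t, g2 t) => //; split => //; split => /=; exists t.
Qed.

End two_simple.

Section one_simple.
Context {V : normedModType K}.
Implicit Types g : T -> V.

Lemma simple_preimage g (P : V -> Prop) : simple_fun mu g ->
  measurable [set t | P (g t)].
Proof. by move=> sg; exact: (simple_preimage2 sg sg (fun x _ => P x)). Qed.

Lemma simple_measurable g (phi : V -> R) : simple_fun mu g ->
  measurable_fun setT (fun t => phi (g t)).
Proof.
move=> sg _ Y mY; rewrite setTI.
exact: (simple_preimage (fun v => Y (phi v)) sg).
Qed.

Lemma simple_support_fin g : simple_fun mu g ->
  (mu [set t | g t != 0%R] < +oo)%E.
Proof.
move=> [fg mg mfin].
have fin0 : finite_set (range g `\ 0) by exact: finite_setD.
rewrite (_ : [set t | _] = \bigcup_(v in range g `\ 0) (g @^-1` [set v])).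
  rewrite measure_fin_bigcup//; last exact: trivIset_preimage1.
  rewrite fsbig_finite//= big_seq_cond; apply: lte_sum_pinfty => v.
  rewrite andbT in_fset_set// inE => -[_ /= v0]; apply: mfin.
  exact/eqP.
rewrite predeqE => t; split=> [/= gt|[v [_ /= v0] /= ->]]; last exact/eqP.
exists (g t) => //=; split; [by exists t|exact/eqP].
Qed.

End one_simple.

Lemma simple_op2 (V1 V2 V3 : normedModType K) (op : V1 -> V2 -> V3) g1 g2 :
  op 0 0 = 0 -> simple_fun mu g1 -> simple_fun mu g2 ->
  simple_fun mu (fun t => op (g1 t) (g2 t)).
Proof.
move=> op0 sg1 sg2; have [f1 m1 _] := sg1; have [f2 m2 _] := sg2.
have mop v : measurable ((fun t => op (g1 t) (g2 t)) @^-1` [set v]).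
  exact: (simple_preimage2 sg1 sg2 (fun x y => op x y = v)).
split => //.
  apply: (@sub_finite_set _ _
    ((fun p => op p.1 p.2) @` (range g1 `*` range g2))).
    by move=> _ [t _ <-]; exists (g1 t, g2 t) => //; split; exists t.
  by apply/finite_image/finite_setX.
move=> v v0.
have ms1 : measurable [set t | g1 t != 0%R].
  exact: (simple_preimage (fun v => v != 0) sg1).
have ms2 : measurable [set t | g2 t != 0%R].
  exact: (simple_preimage (fun v => v != 0) sg2).
apply: (@le_lt_trans _ _
  (mu ([set t | g1 t != 0%R] `|` [set t | g2 t != 0%R]))).
  apply: le_measure; rewrite ?inE//; first exact: measurableU.
  move=> t /= gt; apply/orP; rewrite -negb_and.
  by apply: contra v0 => /andP[/eqP g10 /eqP g20]; rewrite -gt g10 g20 op0.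
apply: (le_lt_trans (measureU2 _ _ _)) => //.
by rewrite lte_add_pinfty ?simple_support_fin.
Qed.

Lemma simple_op1 (V1 V2 : normedModType K) (op : V1 -> V2) g :
  op 0 = 0 -> simple_fun mu g -> simple_fun mu (fun t => op (g t)).
Proof.
by move=> op0 sg; exact: (simple_op2 (op := fun x _ => op x) op0 sg sg).
Qed.

Lemma simple_restrict (V : normedModType K) (A : set T) (g : T -> V) :
  measurable A -> simple_fun mu g ->
  simple_fun mu (fun t => if t \in A then g t else 0).
Proof.
move=> mA sg; have [fg mg gfin] := sg.
split.
- apply: (@sub_finite_set _ _ (range g `|` [set 0])).
    move=> _ [t _ <-]; case: ifP => _; [by left; exists t|by right].
  by rewrite finite_setU; split.
- move=> v; rewrite (_ : _ @^-1` _ = (A `&` g @^-1` [set v]) `|`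
    (~` A `&` [set t | 0 = v])).
    apply: measurableU; first exact: measurableI.
    apply: measurableI; first exact: measurableC.
    have [->|v0] := eqVneq v 0.
      by rewrite (_ : [set _ | _] = setT)// predeqE.
    rewrite (_ : [set _ | _] = set0)// predeqE => t; split => //= vE.
    by move: v0; rewrite vE eqxx.
  rewrite predeqE => t /=; have [/set_mem At|/negP] := boolP (t \in A).
    by split=> [gt|[[]//|[]//]]; left.
  rewrite inE => At; split=> [v0|[[]//|[]//]]; by right.
- move=> v v0; apply: (@le_lt_trans _ _ (mu (g @^-1` [set v])));
    last exact: gfin.
  have mgv := mg v.
  rewrite (_ : _ @^-1` _ = A `&` g @^-1` [set v]).
    apply: le_measure; rewrite ?inE//; first exact: measurableI.
  rewrite predeqE => t /=; have [/set_mem At|/negP] := boolP (t \in A).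
    by split=> [gt|[]].
  by rewrite inE => At; split=> [vE|[]//]; move: v0; rewrite vE eqxx.
Qed.

Lemma simple0 (V : normedModType K) : simple_fun mu (fun=> 0 : V).
Proof.
split.
- apply: (@sub_finite_set _ _ [set 0]) => //.
  by move=> _ [t _ <-].
- move=> v; have [->|v0] := eqVneq v 0.
    by rewrite (_ : _ @^-1` _ = setT)// predeqE.
  rewrite (_ : _ @^-1` _ = set0)// predeqE => t; split => //= vE.
  by move: v0; rewrite vE eqxx.
- move=> v v0; rewrite (_ : _ @^-1` _ = set0) ?measure0// predeqE => t.
  by split => //= vE; move: v0; rewrite vE eqxx.
Qed.

(** Linear over the reals only, so that over complex scalars the real part of
    an inner product qualifies in either argument. *)
Definition real_form (V : lmodType K) (l : V -> R) :=
  (forall x y, l (x + y) = l x + l y) /\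
  (forall a x, l (of_real s a *: x) = a * l x).

Lemma real_form0 (V : lmodType K) (l : V -> R) : real_form l -> l 0 = 0.
Proof. by move=> [_ lZ]; rewrite -(scaler0 _ (of_real s 0)) lZ mul0r. Qed.

Lemma real_form_sum (V : lmodType K) (l : V -> R) J (r : seq J) (P : pred J)
    (u : J -> V) : real_form l ->
  l (\sum_(j <- r | P j) u j) = \sum_(j <- r | P j) l (u j).
Proof.
move=> rl; elim: r => [|j r IH]; first by rewrite !big_nil real_form0.
by rewrite !big_cons; case: ifP => // _; rewrite rl.1 IH.
Qed.

(** Testing with real-linear forms replaces the algebra of simple functions on
    common refinements by the linearity of the real integral. *)
Lemma simple_integral_form (V : normedModType K) (l : V -> R) (g : T -> V) :
  real_form l -> simple_fun mu g ->
  ae_integrable mu (fun t => l (g t)) /\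
  l (simple_integral mu g) = I (fun t => l (g t)).
Proof.
move=> rl [fg mg gfin].
set r := finmap.enum_fset (fset_set (range g)).
have lgE t : l (g t) = \sum_(v <- r) l v * \1_(g @^-1` [set v]) t.
  have gr : g t \in r by rewrite in_fset_set// inE; exists t.
  rewrite (bigD1_seq (g t)) ?finmap.fset_uniq//= indicE mem_set// mulr1.
  by rewrite big1 ?addr0// => v vg;
    rewrite indicE memNset ?mulr0//= => /esym/eqP; exact/negP.
have ind v : v != 0 -> ae_integrable mu (\1_(g @^-1` [set v])) /\
    I (\1_(g @^-1` [set v])) = fine (mu (g @^-1` [set v])).
  move=> v0; have mgv := mg v.
  have intE : (\int[mu]_t (\1_(g @^-1` [set v]) t)%:E = mu (g @^-1` [set v]))%E.
    by rewrite integral_indic// setIT.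
  split; last by rewrite /Rintegral intE.
  apply: ae_integrable_ge0; first by exists (\1_(g @^-1` [set v])) => //;
    exact: nearW.
    by move=> t; rewrite indicE.
  by rewrite intE; exact: gfin.
have ilv v : ae_integrable mu (fun t => l v * \1_(g @^-1` [set v]) t) /\
    I (fun t => l v * \1_(g @^-1` [set v]) t) = fine (mu (g @^-1` [set v]))
      * l v.
  have [->|v0] := eqVneq v 0.
    rewrite real_form0// mulr0; split.
      by apply: eq_ae_integrable (ae_integrable0 mu); apply: nearW => t;
        rewrite mul0r.
    transitivity (I (fun=> 0)); first by apply: eq_Rintegral => t _;
      rewrite mul0r.
    by rewrite /Rintegral integral0.
  have [iv Iv] := ind v v0; split; first exact: ae_integrableZ.
  by rewrite Rintegral_aeZ// Iv mulrC.
have [isum Isum] := Rintegral_ae_sum r (P := xpredT) (fun v _ => (ilv v).1).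
split; first by apply: eq_ae_integrable isum; apply: nearW => t; rewrite lgE.
under eq_Rintegral do rewrite lgE.
rewrite Isum /simple_integral fsbig_finite//= real_form_sum//.
by apply: eq_bigr => v _; rewrite rl.2 (ilv v).2.
Qed.

Section strongly_measurable.
Implicit Types (V : normedModType K).

Lemma sm_simple V (g : T -> V) : simple_fun mu g -> strongly_measurable mu g.
Proof.
by move=> sg; exists (fun=> g) => //; apply: nearW => t; exact: cvg_cst.
Qed.

Lemma sm_ae V (f g : T -> V) : (\forall t \ae mu, f t = g t) ->
  strongly_measurable mu f -> strongly_measurable mu g.
Proof.
move=> fg [u su uf]; exists u => //.
by apply: filterS2 fg uf => t ->.
Qed.

Lemma sm_op2 (V1 V2 V3 : normedModType K) (op : V1 -> V2 -> V3) f1 f2 :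
  op 0 0 = 0 ->
  (forall (u : nat -> V1) (v : nat -> V2) x y, u @ \oo --> x -> v @ \oo --> y ->
    (fun n => op (u n) (v n)) @ \oo --> op x y) ->
  strongly_measurable mu f1 -> strongly_measurable mu f2 ->
  strongly_measurable mu (fun t => op (f1 t) (f2 t)).
Proof.
move=> op0 opc [u1 s1 c1] [u2 s2 c2].
exists (fun n t => op (u1 n t) (u2 n t)); first by move=> n; exact: simple_op2.
by apply: filterS2 c1 c2 => t; exact: opc.
Qed.

Lemma sm_op1 (V1 V2 : normedModType K) (op : V1 -> V2) f :
  op 0 = 0 ->
  (forall (u : nat -> V1) x, u @ \oo --> x ->
    (fun n => op (u n)) @ \oo --> op x) ->
  strongly_measurable mu f -> strongly_measurable mu (fun t => op (f t)).
Proof.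
move=> op0 opc sf; apply: (sm_op2 (op := fun x _ => op x) op0 _ sf sf).
by move=> u v x y ux _; exact: opc.
Qed.

Lemma sm_real2 (V1 V2 : normedModType K) (phi : V1 -> V2 -> R) f1 f2 :
  (forall (u : nat -> V1) (v : nat -> V2) x y, u @ \oo --> x -> v @ \oo --> y ->
    (fun n => phi (u n) (v n)) @ \oo --> phi x y) ->
  strongly_measurable mu f1 -> strongly_measurable mu f2 ->
  ae_measurable mu (fun t => phi (f1 t) (f2 t)).
Proof.
move=> phic [u1 s1 c1] [u2 s2 c2].
apply: (ae_measurable_cvg (h_ := fun n t => phi (u1 n t) (u2 n t))).
  move=> n; exists (fun t => phi (u1 n t) (u2 n t)); last exact: nearW.
  move=> _ Y mY; rewrite setTI.
  exact: (simple_preimage2 (s1 n) (s2 n) (fun x y => Y (phi x y))).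
by apply: filterS2 c1 c2 => t; exact: phic.
Qed.

Lemma cvg_rnorm_of V (u : nat -> V) x : u @ \oo --> x ->
  (fun n => rnorm (u n)) @ \oo --> rnorm x.
Proof.
move=> /cvg_rnorm/cvgrPdist_le ux; apply/cvgrPdist_le => e e0.
have := ux e e0; apply: filterS => n;
  rewrite sub0r normrN ger0_norm ?rnorm_ge0//.
apply: le_trans; rewrite ler_norml; apply/andP; split.
  by rewrite lerNl opprB lerBlDr (le_trans _ (rnormD _ _))// subrK.
by rewrite lerBlDr rnormBC (le_trans _ (rnormD _ _))// subrK.
Qed.

Lemma sm_rnorm V p (f : T -> V) : strongly_measurable mu f ->
  ae_measurable mu (fun t => rnorm (f t) ^+ p).
Proof.
move=> sf; apply: (sm_real2 (phi := fun x _ => rnorm x ^+ p) _ sf sf).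
by move=> u v x y /cvg_rnorm_of ux _; apply: cvg_pow.
Qed.

(** An approximating simple function is replaced by 0 where it exceeds twice
    the norm of [f]. At a point where [f] does not vanish this happens finitely
    often only, and at a zero of [f] the new values are 0. *)
Lemma sm_approx V (f : T -> V) : strongly_measurable mu f ->
  exists g : nat -> T -> V, [/\ forall n, simple_fun mu (g n),
    \forall t \ae mu, (fun n => g n t) @ \oo --> f t &
    forall n, \forall t \ae mu, rnorm (g n t) <= 2 * rnorm (f t)].
Proof.
move=> sf; have [u su uf] := sf; have [h mh hf] := sm_rnorm 1 sf.
pose A n := [set t | rnorm (u n t) <= 2 * h t].
have mA n : measurable (A n).
  rewrite -[A n]setTI; apply: measurable_fun_le => //.
    exact: simple_measurable.
  exact: measurable_funM.
exists (fun n t => if t \in A n then u n t else 0); split.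
- by move=> n; exact: simple_restrict.
- apply: filterS2 hf uf => t; rewrite expr1 => ht /cvg_rnorm uft.
  have [ft0|ft0] := eqVneq (rnorm (f t)) 0.
    rewrite (rnorm_eq0 ft0).
    apply/cvg_rnorm; rewrite (_ : (fun _ => _) = fun=> 0); first exact: cvg_cst.
    apply/funext => n; rewrite subr0; case: ifP;
      rewrite ?rnorm0// inE /A/= -ht ft0.
    by rewrite mulr0 => un0; apply/eqP; rewrite eq_le un0 rnorm_ge0.
  have ft1 : 0 < rnorm (f t) by rewrite lt_neqAle eq_sym ft0 rnorm_ge0.
  have /cvgrPdist_le/(_ _ ft1) unt : rnorm (u n t) @[n --> \oo] --> rnorm (f t).
    exact/cvg_rnorm_of/cvg_rnorm.
  apply/cvg_rnorm; apply: cvg_trans uft; apply: near_eq_cvg.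
  apply: filterS unt => n; rewrite ler_norml => /andP[unf _].
  rewrite mem_set// /A/= -ht.
  by move: unf; rewrite lerBrDl; lra.
- move=> n; apply: filterS hf => t; rewrite expr1 => ht.
  case: ifPn => [|_]; first by rewrite inE /A/= -ht.
  by rewrite rnorm0 mulr_ge0 ?rnorm_ge0.
Qed.

(** Dominated convergence along [sm_approx]: there [|f - g_n| <= 3 |f|]. *)
Lemma simple_dense V p (f : T -> V) : strongly_measurable mu f ->
  ae_integrable mu (fun t => rnorm (f t) ^+ p.+1) ->
  exists g : nat -> T -> V, [/\ forall n, simple_fun mu (g n),
    \forall t \ae mu, (fun n => g n t) @ \oo --> f t,
    forall n, ae_integrable mu (fun t => rnorm (f t - g n t) ^+ p.+1) &
    I (fun t => rnorm (f t - g n t) ^+ p.+1) @[n --> \oo] --> (0 : R)].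
Proof.
move=> sf iff; have [g [sg gf gle]] := sm_approx sf.
have mD n : ae_measurable mu (fun t => rnorm (f t - g n t) ^+ p.+1).
  apply: (sm_real2 (phi := fun x y => rnorm (x - y) ^+ p.+1) _ sf
    (sm_simple (sg n))).
  by move=> u v x y ux vy; apply/cvg_pow/cvg_rnorm_of; exact: cvgB.
have leD n : \forall t \ae mu,
    `|rnorm (f t - g n t) ^+ p.+1| <= 3 ^+ p.+1 * rnorm (f t) ^+ p.+1.
  apply: filterS (gle n) => t gt.
  rewrite ger0_norm ?exprn_ge0 ?rnorm_ge0// -exprMn lerXn2r ?nnegrE
    ?rnorm_ge0//.
    by rewrite mulr_ge0 ?rnorm_ge0.
  by rewrite (le_trans (rnormB _ _))//; lra.
have i3 := ae_integrableZ (3 ^+ p.+1) iff.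
exists g; split => //.
  by move=> n; exact: ae_integrable_dom (mD n) i3 (leD n).
apply: ae_dominated_cvg0 mD i3 _ leD.
apply: filterS gf => t /cvg_rnorm gt.
rewrite [X in _ --> X](_ : _ = 0 ^+ p.+1); last by rewrite exprS mul0r.
by apply: cvg_pow; under eq_fun do rewrite rnormBC.
Qed.

End strongly_measurable.

End simple_theory.

(** * Inner products and completeness *)

Section inner_products.
Context {R : realType} {s : scalar_kind}.
Local Notation K := (scalars R s).

(** A common setting for Hilbert spaces and for the scalar field itself, in
    which both kinds of Bochner integrals in the POD operator and in the inner
    product of [L^2(T; K^m)] take their values. *)
Definition real_ip (V : normedModType K) (ip : V -> V -> R) :=
  [/\ forall y, real_form (ip ^~ y), forall x y, ip x y = ip y x &
      forall x, ip x x = rnorm x ^+ 2].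

Definition seq_complete (V : normedModType K) := forall u : nat -> V,
  (forall e : R, 0 < e -> exists N, forall m n, (N <= m)%N -> (N <= n)%N ->
    rnorm (u m - u n) < e) -> exists l : V, u @ \oo --> l.

Section real_ip_theory.
Context {V : normedModType K} (ip : V -> V -> R).
Hypothesis ipV : real_ip ip.
Implicit Types (x y z : V).

Lemma ipC x y : ip x y = ip y x. Proof. by case: ipV. Qed.
Lemma ip_sqr x : ip x x = rnorm x ^+ 2. Proof. by case: ipV. Qed.
Lemma ip_form y : real_form (ip ^~ y). Proof. by case: ipV. Qed.
Lemma ipDl x y z : ip (x + y) z = ip x z + ip y z.
Proof. by case: (ip_form z) => ->. Qed.
Lemma ipZl a x z : ip (of_real s a *: x) z = a * ip x z.
Proof. by case: (ip_form z) => _ ->. Qed.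
Lemma ipDr x y z : ip x (y + z) = ip x y + ip x z.
Proof. by rewrite ipC ipDl !(ipC x). Qed.
Lemma ipZr a x z : ip x (of_real s a *: z) = a * ip x z.
Proof. by rewrite ipC ipZl ipC. Qed.
Lemma ipNl x z : ip (- x) z = - ip x z.
Proof. by rewrite -scaleN1r -(ofR1 (R := R)) -ofRN ipZl mulN1r. Qed.
Lemma ipNr x z : ip x (- z) = - ip x z.
Proof. by rewrite ipC ipNl ipC. Qed.
Lemma ipBl x y z : ip (x - y) z = ip x z - ip y z.
Proof. by rewrite ipDl ipNl. Qed.
Lemma ipBr x y z : ip x (y - z) = ip x y - ip x z.
Proof. by rewrite ipDr ipNr. Qed.
Lemma ip0l z : ip 0 z = 0.
Proof. exact: real_form0 (ip_form z). Qed.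
Lemma ip0r z : ip z 0 = 0.
Proof. by rewrite ipC ip0l. Qed.

Lemma ip_ext x y : (forall z, ip x z = ip y z) -> x = y.
Proof.
move=> xy; apply/eqP; rewrite -subr_eq0; apply/eqP/rnorm_eq0/eqP.
by rewrite -sqrf_eq0 -ip_sqr ipBl xy subrr.
Qed.

Lemma ip_cauchy_schwarz x y : `|ip x y| <= rnorm x * rnorm y.
Proof.
have [->|y0] := eqVneq y 0; first by rewrite ip0r normr0 mulr_ge0 ?rnorm_ge0.
rewrite -ler_sqr ?nnegrE ?mulr_ge0 ?rnorm_ge0// exprMn -normrX ger0_norm
  ?sqr_ge0//.
have c0 : 0 < ip y y.
  rewrite ip_sqr exprn_gt0// lt_neqAle rnorm_ge0 andbT eq_sym.
  by apply: contra y0 => /eqP/rnorm_eq0 ->.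
(* the square of |y|^2 times the residual of projecting x onto y *)
have := sqr_ge0 (rnorm (of_real s (ip y y) *: x - of_real s (ip x y) *: y)).
rewrite -ip_sqr -!ip_sqr !(ipBl, ipBr, ipZl, ipZr) (ipC y x).
move: c0; set a := ip x x; set b := ip x y; set c := ip y y => c0 h.
rewrite -(ler_pM2l c0); move: h; nra.
Qed.

End real_ip_theory.

Lemma complete_seq (K' : numFieldType) (V : completeNormedModType K')
    (u : nat -> V) :
  (forall e : K', 0 < e -> exists N, forall m n, (N <= m)%N -> (N <= n)%N ->
    `|u m - u n| < e) -> exists l : V, u @ \oo --> l.
Proof.
move=> uc; apply/cvg_ex; apply: cauchy_cvg; apply: cauchy_exP => e e0.
have [N uN] := uc e e0; exists (u N).
by exists N => // n /= Nn; rewrite -ball_normE /=; exact: uN.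
Qed.

Lemma complete_seq_complete (V : completeNormedModType K) : seq_complete V.
Proof.
move=> u uc; apply: complete_seq => e e0; have eE := ge0_ofR (ltW e0).
have [|N uN] := uc (re e); first by move: e0;
  rewrite {1}eE -[X in X < _]ofR0 ofR_lt.
by exists N => m n Nm Nn; rewrite normE eE ofR_lt uN.
Qed.

Lemma real_complete (u : nat -> R) :
  (forall e : R, 0 < e -> exists N, forall m n, (N <= m)%N -> (N <= n)%N ->
    `|u m - u n| < e) -> exists l : R, u @ \oo --> l.
Proof. exact: (@complete_seq _ R^o). Qed.

Variable X : sep_hilbert R s.

Lemma dotC (x y : X) : dotH X x y = scalar_conj (dotH X y x).
Proof.
by have := @hermitian_subproof _ _ _ _ (dotH X) x y; rewrite expr0 mul1r.
Qed.
Lemma dotBl (x y z : X) : dotH X (x - y) z = dotH X x z - dotH X y z.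
Proof. exact: (@zmod_morphisml_subproof _ _ _ _ _ _ (dotH X) z x y). Qed.
Lemma dotZl a (x z : X) : dotH X (a *: x) z = a * dotH X x z.
Proof. exact: (@linearl_subproof _ _ _ _ _ _ (dotH X) z a x). Qed.
Lemma dot0l z : dotH X 0 z = 0.
Proof. by rewrite -(scale0r 0) dotZl mul0r. Qed.
Lemma dotNl x z : dotH X (- x) z = - dotH X x z.
Proof. by rewrite -scaleN1r dotZl mulN1r. Qed.
Lemma dotDl (x y z : X) : dotH X (x + y) z = dotH X x z + dotH X y z.
Proof. by rewrite -{1}(opprK y) dotBl dotNl opprK. Qed.
Lemma dotDr (x y z : X) : dotH X x (y + z) = dotH X x y + dotH X x z.
Proof. by rewrite dotC dotDl conjD -!dotC. Qed.
Lemma dotZr a (x z : X) : dotH X x (a *: z) = scalar_conj a * dotH X x z.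
Proof. by rewrite dotC dotZl conjM -dotC. Qed.

Definition rdot (x y : X) := re (dotH X x y).

Lemma rdot_ip : real_ip rdot.
Proof.
split.
- move=> y; split; rewrite /rdot => *; first by rewrite dotDl reD.
  by rewrite dotZl re_ofRM.
- by move=> x y; rewrite /rdot dotC re_conj.
- by move=> x; rewrite /rdot dotE normE -ofRX re_ofR.
Qed.

Definition scalar_dot (x y : K^o) := re (x * scalar_conj y).

Lemma scalar_dot_ip : @real_ip (K^o) scalar_dot.
Proof.
split.
- move=> y; split; rewrite /scalar_dot => *; first by rewrite mulrDl reD.
  by rewrite -re_ofRM mulrA.
- by move=> x y; rewrite /scalar_dot -[RHS]re_conj conjM conjK mulrC.
- by move=> x; rewrite /scalar_dot mul_conj;
    rewrite [X in X ^+ 2]normE -ofRX re_ofR.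
Qed.

Lemma scalar_ext (x a : K) : (forall c, re (c * x) = re (c * a)) -> x = a.
Proof.
by move=> xa; apply: (ip_ext scalar_dot_ip) => z;
  rewrite /scalar_dot mulrC xa mulrC.
Qed.

End inner_products.
Arguments rdot {R s X} x y.

(** The complex case reduces to the real one through real and imaginary parts.
    *)
Lemma scalar_complete (R : realType) (s : scalar_kind) :
  @seq_complete R s ((scalars R s)^o).
Proof.
case: s => u uc; first exact: real_complete.
have uc' (g : R[i] -> R) : (forall x y, g (x - y) = g x - g y) ->
    (forall x, `|g x| <= complex.Re `|x|) ->
    exists l : R, (fun n => g (u n)) @ \oo --> l.
  move=> gB gle; apply: real_complete => e e0; have [N uN] := uc e e0.
  exists N => m n Nm Nn; rewrite -gB; exact: le_lt_trans (gle _) (uN _ _ Nm Nn).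
have [|x|a ua] := uc' (@complex.Re R).
- by move=> [? ?] [? ?].
- exact: (@re_le_norm R ComplexScalars).
have [|[x y]|b ub] := uc' (@complex.Im R).
- by move=> [? ?] [? ?].
- rewrite /= -[leLHS]sqrtr_sqr ler_sqrt ?lerDr ?sqr_ge0//.
  by rewrite addr_ge0 ?sqr_ge0.
exists (a +i* b)%C; apply/(@cvg_rnorm R ComplexScalars).
apply: (@squeeze_cvgr _ _ _ _ (fun=> 0)
  (fun n => `|complex.Re (u n) - a| + `|complex.Im (u n) - b|)).
- apply: nearW => n; rewrite rnorm_ge0/= /rnorm /=.
  case: (u n) => x y /=.
  rewrite -ler_sqr ?nnegrE ?sqrtr_ge0 ?addr_ge0 ?normr_ge0//.
  rewrite sqr_sqrtr ?addr_ge0 ?sqr_ge0//.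
  rewrite -[in leLHS](real_normK (num_real (x - a))).
  rewrite -[in leLHS](real_normK (num_real (y - b))).
  rewrite sqrrD lerD2r lerDl mulrn_wge0// mulr_ge0//.
- exact: cvg_cst.
- rewrite -[X in _ --> X](addr0 0); apply: cvgD.
    by apply/norm_cvg0P; move/subr_cvg0 : ua.
  by apply/norm_cvg0P; move/subr_cvg0 : ub.
Qed.

(** * The Bochner integral through real-linear forms *)

Section bochner_theory.
Context {R : realType} {s : scalar_kind} {d : measure_display}
  {T : measurableType d} (mu : {measure set T -> \bar R}).
Local Notation K := (scalars R s).
Local Notation I h := (Rintegral mu setT h).

Definition bochner_integrable (V : normedModType K) (f : T -> V) :=
  strongly_measurable mu f /\ ae_integrable mu (fun t => rnorm (f t)).

Definition bounded_form (V : normedModType K) (l : V -> R) :=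
  exists C, forall x, `|l x| <= C * rnorm x.

Lemma bounded_form_ge0 (V : normedModType K) (l : V -> R) : bounded_form l ->
  exists2 C, 0 <= C & forall x, `|l x| <= C * rnorm x.
Proof.
move=> [C lC]; exists `|C|; first exact: normr_ge0.
by move=> x; rewrite (le_trans (lC x))// ler_wpM2r ?rnorm_ge0 ?ler_norm.
Qed.

Lemma bounded_form_cvg (V : normedModType K) (l : V -> R)
    (u : nat -> V) (x : V) :
  real_form l -> bounded_form l -> u @ \oo --> x ->
    (fun n => l (u n)) @ \oo --> l x.
Proof.
move=> [lD lZ] /bounded_form_ge0[C C0 lC] /cvg_rnorm ux.
have lB a b : l (a - b) = l a - l b.
  by rewrite lD -scaleN1r -(ofR1 (R := R)) -ofRN lZ mulN1r.
apply/subr_cvg0/norm_cvg0P.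
apply: (@squeeze_cvgr _ _ _ _ (fun=> 0) (fun n => C * rnorm (u n - x))).
- by apply: nearW => n; rewrite normr_ge0 -lB lC.
- exact: cvg_cst.
- by rewrite -[X in _ --> X](mulr0 C); apply: cvgM => //; exact: cvg_cst.
Qed.

Section one_space.
Context {V : normedModType K}.
Implicit Types f g : T -> V.

Lemma bochner_integrable_simple g : simple_fun mu g -> bochner_integrable g.
Proof.
move=> sg; split; first exact: sm_simple.
have sn := simple_op1 (V2 := K^o) (op := fun x : V => of_real s (rnorm x)) _ sg.
have [] := @simple_integral_form R s d T mu (K^o) (@re R s) _ _ (sn _).
- by split=> *; rewrite ?reD ?re_ofRM.
- by rewrite rnorm0 ofR0.
by move=> + _; apply: eq_ae_integrable; apply: nearW => t; rewrite re_ofR.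
Qed.

Lemma sm_B f g : strongly_measurable mu f -> strongly_measurable mu g ->
  strongly_measurable mu (fun t => f t - g t).
Proof.
move=> sf sg; apply: (sm_op2 (op := fun x y => x - y) _ _ sf sg).
  by rewrite subr0.
by move=> u v x y; exact: cvgB.
Qed.

Lemma bochner_integrableB f g : bochner_integrable f -> bochner_integrable g ->
  bochner_integrable (fun t => f t - g t).
Proof.
move=> [sf iff] [sg ig]; have sB := sm_B sf sg; split => //.
apply: ae_integrable_dom (ae_integrableD iff ig) _.
  by apply: eq_ae_measurable (sm_rnorm 1 sB); apply: nearW => t; rewrite expr1.
by apply: nearW => t; rewrite ger0_norm ?rnorm_ge0// rnormB.
Qed.

Lemma ae_integrable_form l f : real_form l -> bounded_form l ->
  bochner_integrable f ->
  ae_integrable mu (fun t => l (f t)).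
Proof.
move=> rl bl [sf iff]; have [C C0 lC] := bounded_form_ge0 bl.
apply: (ae_integrable_dom _ (ae_integrableZ C iff)); last exact: nearW.
apply: (sm_real2 (phi := fun x _ => l x) _ sf sf) => u _ x _ ux _.
exact: bounded_form_cvg.
Qed.

(** The identity holds for the approximating simple functions, and both sides
    pass to the limit because [l] is bounded. *)
Lemma is_bochner_form l f (x : V) : real_form l -> bounded_form l ->
  bochner_integrable f ->
  is_bochner mu f x -> l x = I (fun t => l (f t)).
Proof.
move=> rl bl sf [_ [g [sg fg gx]]].
have iB n := (bochner_integrableB sf (bochner_integrable_simple (sg n))).2.
have lB a b : l (a - b) = l a - l b.
  by rewrite rl.1 -scaleN1r -(ofR1 (R := R)) -ofRN rl.2 mulN1r.
have {}fg : I (fun t => rnorm (f t - g n t)) @[n --> \oo] --> 0.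
  move/fine_cvg : fg; apply: cvg_trans; apply: near_eq_cvg.
  by apply: nearW => n; rewrite /= ae_integral_EFin.
have lg := bounded_form_cvg rl bl gx.
have [C C0 lC] := bounded_form_ge0 bl.
suff : (fun n => l (simple_integral mu (g n))) @ \oo --> I (fun t => l (f t)).
  move=> /(cvg_lim (@Rhausdorff R)) <-.
  by rewrite (cvg_lim (@Rhausdorff R) lg).
apply/subr_cvg0/norm_cvg0P.
apply: (@squeeze_cvgr _ _ _ _ (fun=> 0)
  (fun n => C * I (fun t => rnorm (f t - g n t)))).
- apply: nearW => n; rewrite normr_ge0/=.
  have [ig ->] := simple_integral_form rl (sg n).
  have ilf := ae_integrable_form rl bl sf.
  rewrite -Rintegral_aeB// -Rintegral_aeZ//;
    apply: (le_trans (Rintegral_ae_abs (ae_integrableB ig ilf))).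
  apply: Rintegral_ae_le;
    [exact/ae_integrable_norm/ae_integrableB|exact: ae_integrableZ|].
  by apply: nearW => t; rewrite -lB rnormBC.
- exact: cvg_cst.
- by rewrite -[X in _ --> X](mulr0 C); apply: cvgM => //; exact: cvg_cst.
Qed.

Section with_ip.
Variable ip : V -> V -> R.
Hypotheses (ipV : real_ip ip) (cV : seq_complete V).

Lemma ip_bounded y : bounded_form (ip ^~ y).
Proof. by exists (rnorm y) => x; rewrite mulrC ip_cauchy_schwarz. Qed.

(** If [x] is the integral, then [|x|^2] is the integral of [(g, x)], which is
    at most [|x|] times the integral of [|g|]. *)
Lemma simple_integral_le g : simple_fun mu g ->
  rnorm (simple_integral mu g) <= I (fun t => rnorm (g t)).
Proof.
move=> sg; set x := simple_integral mu g.
have [ig Ex] := simple_integral_form (ip_form ipV x) sg.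
have [x0|x0] := eqVneq (rnorm x) 0; first by rewrite x0 Rintegral_ge0T// => t;
  exact: rnorm_ge0.
have xp : 0 < rnorm x by rewrite lt_neqAle eq_sym x0 rnorm_ge0.
rewrite -(ler_pM2l xp) -expr2 -(ip_sqr ipV) Ex -Rintegral_aeZ;
  last exact: (bochner_integrable_simple sg).2.
apply: Rintegral_ae_le => //;
  first exact/ae_integrableZ/(bochner_integrable_simple sg).2.
by apply: nearW => t; rewrite mulrC (le_trans (ler_norm _))// ip_cauchy_schwarz.
Qed.

Lemma simple_B g1 g2 : simple_fun mu g1 -> simple_fun mu g2 ->
  simple_fun mu (fun t => g1 t - g2 t).
Proof.
by move=> s1 s2; apply: (simple_op2 (op := fun x y => x - y) _ s1 s2);
  rewrite subr0.
Qed.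

Lemma simple_integralB g1 g2 : simple_fun mu g1 -> simple_fun mu g2 ->
  simple_integral mu (fun t => g1 t - g2 t) =
  simple_integral mu g1 - simple_integral mu g2.
Proof.
move=> s1 s2; apply: (ip_ext ipV) => z; rewrite (ipBl ipV).
have [_ ->] := simple_integral_form (ip_form ipV z) (simple_B s1 s2).
have [i1 ->] := simple_integral_form (ip_form ipV z) s1.
have [i2 ->] := simple_integral_form (ip_form ipV z) s2.
by rewrite -Rintegral_aeB//; apply: eq_Rintegral => t _; rewrite (ipBl ipV).
Qed.

(** By [simple_integral_le] the integrals of simple functions that converge to
    [f] in the mean form a Cauchy sequence. *)
Lemma bochner_exists f : bochner_integrable f -> exists x, is_bochner mu f x.
Proof.
move=> [sf iff]; have [|g [sg gf ig Ig]] := simple_dense (p := 0) sf.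
  by apply: eq_ae_integrable iff; apply: nearW => t; rewrite expr1.
have iB n := (bochner_integrableB (conj sf iff)
  (bochner_integrable_simple (sg n))).2.
have {}Ig : I (fun t => rnorm (f t - g n t)) @[n --> \oo] --> 0.
  apply: cvg_trans Ig; apply: near_eq_cvg; apply: nearW => n.
  by apply: eq_Rintegral => t _; rewrite expr1.
have [x gx] : exists x : V, (fun n => simple_integral mu (g n)) @ \oo --> x.
  apply: cV => e e0; have e2 : 0 < e / 2 by rewrite divr_gt0.
  move/cvgrPdist_lt : Ig => /(_ _ e2)[N _ NP]; exists N => m n Nm Nn.
  have := NP _ Nm; have := NP _ Nn; rewrite /= !sub0r !normrN.
  rewrite !ger0_norm ?Rintegral_ge0T//; try by move=> ?; exact: rnorm_ge0.
  move=> Pn Pm; rewrite -simple_integralB//.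
  apply: (le_lt_trans (simple_integral_le (simple_B (sg m) (sg n)))).
  apply: (@le_lt_trans _ _
    (I (fun t => rnorm (f t - g m t)) + I (fun t => rnorm (f t - g n t))));
    last by lra.
  rewrite -Rintegral_aeD//; apply: Rintegral_ae_le; [|exact: ae_integrableD|].
    exact: (bochner_integrable_simple (simple_B (sg m) (sg n))).2.
  apply: nearW => t; rewrite (rnormBC (f t) (g m t)).
  by rewrite (le_trans _ (rnormD _ _))// addrA subrK.
exists x; split => //; exists g; split => //.
rewrite (_ : (fun n => _) = (fun n => (I (fun t => rnorm (f t - g n t)))%:E)).
  by apply: cvg_EFin => //; exact: nearW.
by apply/funext => n; rewrite ae_integral_EFin.
Qed.

Lemma bochnerP f : bochner_integrable f -> is_bochner mu f (bochner mu f).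
Proof.
move=> sf; rewrite /bochner; have [x fx] := bochner_exists sf.
exact: (@xgetPex _ 0 [set x | is_bochner mu f x] (ex_intro _ x fx)).
Qed.

Lemma bochner_form l f : real_form l -> bounded_form l ->
  bochner_integrable f ->
  l (bochner mu f) = I (fun t => l (f t)).
Proof. by move=> rl bl sf; apply: is_bochner_form => //; exact: bochnerP. Qed.

Lemma bochner_ext f x : bochner_integrable f ->
  (forall y, ip x y = I (fun t => ip (f t) y)) ->
  bochner mu f = x.
Proof.
move=> sf xf; apply: (ip_ext ipV) => y; rewrite xf.
by apply: (bochner_form (ip_form ipV y)) => //; exact: ip_bounded.
Qed.

End with_ip.

End one_space.

End bochner_theory.

(** * Square-integrable functions and completeness of L^2 *)

Section L2_theory.
Context {R : realType} {s : scalar_kind} {d : measure_display}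
  {T : measurableType d} (mu : {measure set T -> \bar R}).
Local Notation K := (scalars R s).
Local Notation I h := (Rintegral mu setT h).

Definition L2 (V : normedModType K) (f : T -> V) :=
  strongly_measurable mu f /\ ae_integrable mu (fun t => rnorm (f t) ^+ 2).

Definition L2sq (V : normedModType K) (f : T -> V) :=
  I (fun t => rnorm (f t) ^+ 2).

Section one_space.
Context {V : normedModType K}.
Implicit Types f g : T -> V.

Lemma rnorm_sqr_ge0 (x : V) : 0 <= rnorm x ^+ 2.
Proof. exact: sqr_ge0. Qed.

Lemma L2sq_ge0 f : 0 <= L2sq f.
Proof. by apply: Rintegral_ge0T => t; exact: rnorm_sqr_ge0. Qed.

Lemma L2norm_sqr_integral f :
  (L2norm mu f `^ 2 = \int[mu]_t (rnorm (f t) ^+ 2)%:E)%E.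
Proof.
rewrite /L2norm poweR_Lnorm//; apply: eq_integral => t _.
by rewrite gee0_abs ?lee_fin ?rnorm_ge0// poweR_EFin powR_mulrn ?rnorm_ge0.
Qed.

Lemma inL2P f : inL2 mu f <-> L2 f.
Proof.
split=> -[sf fi]; split => //.
  apply: ae_integrable_ge0;
    [exact: sm_rnorm|by move=> t; exact: rnorm_sqr_ge0|].
  by rewrite -L2norm_sqr_integral poweR_lty.
have := L2norm_sqr_integral f; rewrite ae_integral_EFin//.
by case: (L2norm mu f) => [r||]; rewrite ?ltry ?ltNyr// poweRyr.
Qed.

Lemma L2norm_sqr f : L2 f -> (L2norm mu f ^+ 2 = (L2sq f)%:E)%E.
Proof.
move=> [sf fi]; have := L2norm_sqr_integral f; rewrite ae_integral_EFin//.
have : (0 <= L2norm mu f)%E by exact: Lnorm_ge0.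
case: (L2norm mu f) => [r r0||]//; last by rewrite poweRyr.
by rewrite poweR_EFin powR_mulrn.
Qed.

Lemma L2_ae f g : (\forall t \ae mu, f t = g t) -> L2 f -> L2 g.
Proof.
move=> fg [sf iff]; split; first exact: sm_ae sf.
by apply: eq_ae_integrable iff; apply: filterS fg => t ->.
Qed.

Lemma rnormB_sqr (x y z : V) :
  rnorm (x - z) ^+ 2 <= 2 * rnorm (x - y) ^+ 2 + 2 * rnorm (y - z) ^+ 2.
Proof.
have := rnormD (x - y) (y - z); rewrite addrA subrK.
set a := rnorm (x - z); set b := rnorm (x - y); set c := rnorm (y - z) => abc.
have : a ^+ 2 <= (b + c) ^+ 2.
  by rewrite lerXn2r ?nnegrE ?addr_ge0 ?rnorm_ge0.
have := sqr_ge0 (b - c); nra.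
Qed.

Lemma L2_0 : L2 (fun=> 0 : V).
Proof.
split; first exact/sm_simple/simple0.
by apply: eq_ae_integrable (ae_integrable0 mu); apply: nearW => t;
  rewrite rnorm0 expr0n.
Qed.

Lemma L2_B f g : L2 f -> L2 g -> L2 (fun t => f t - g t).
Proof.
move=> [sf iff] [sg ig]; have sB := sm_B sf sg; split => //.
apply: ae_integrable_dom (sm_rnorm 2 sB)
  (ae_integrableD (ae_integrableZ 2 iff) (ae_integrableZ 2 ig)) _.
apply: nearW => t; rewrite ger0_norm ?rnorm_sqr_ge0//.
by have := rnormB_sqr (f t) 0 (g t); rewrite subr0 sub0r rnormN.
Qed.

Lemma L2_D f g : L2 f -> L2 g -> L2 (fun t => f t + g t).
Proof.
move=> lf lg; have := L2_B lf (L2_B L2_0 lg).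
by apply: L2_ae; apply: nearW => t; rewrite sub0r opprK.
Qed.

Lemma L2sq_triangle f g h : L2 f -> L2 g -> L2 h ->
  L2sq (fun t => f t - h t) <=
  2 * L2sq (fun t => f t - g t) + 2 * L2sq (fun t => g t - h t).
Proof.
move=> lf lg lh; have [_ i1] := L2_B lf lg; have [_ i2] := L2_B lg lh.
have [_ i3] := L2_B lf lh.
rewrite /L2sq -!Rintegral_aeZ// -Rintegral_aeD; [|exact: ae_integrableZ..].
apply: Rintegral_ae_le => //; first by apply: ae_integrableD;
  exact: ae_integrableZ.
by apply: nearW => t; exact: rnormB_sqr.
Qed.

Lemma L2sqC f g : L2sq (fun t => f t - g t) = L2sq (fun t => g t - f t).
Proof. by apply: eq_Rintegral => t _; rewrite rnormBC. Qed.

Lemma L2_simple g : simple_fun mu g -> L2 g.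
Proof.
move=> sg; split; first exact: sm_simple.
have sn := simple_op1 (V2 := K^o) (op := fun x : V => of_real s (rnorm x ^+ 2))
  _ sg.
have [] := @simple_integral_form R s d T mu (K^o) (@re R s) _ _ (sn _).
- by split=> *; rewrite ?reD ?re_ofRM.
- by rewrite rnorm0 expr0n ofR0.
by move=> + _; apply: eq_ae_integrable; apply: nearW => t; rewrite re_ofR.
Qed.

Lemma L2_dense f e : L2 f -> 0 < e ->
  exists2 g, simple_fun mu g & L2sq (fun t => f t - g t) < e.
Proof.
move=> [sf iff] e0; have [g [sg _ _ Ig]] := simple_dense sf iff.
have /cvgrPdist_lt/(_ _ e0)[N _ /(_ N (leqnn N))] := Ig.
rewrite /= sub0r normrN => IN; exists (g N) => //.
exact: le_lt_trans (ler_norm _) IN.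
Qed.

Lemma bounded_variation_cvg (x : nat -> V) M : seq_complete V ->
  (forall N, \sum_(k < N) rnorm (x k.+1 - x k) <= M) ->
  exists l : V, x @ \oo --> l.
Proof.
move=> cV xM; apply: cV => e e0.
pose S N := \sum_(k < N) rnorm (x k.+1 - x k).
have ndS : nondecreasing_seq S.
  by apply/nondecreasing_seqP => n; rewrite /S big_ord_recr/= lerDl rnorm_ge0.
have cS : cvgn S.
  apply: nondecreasing_is_cvgn => //.
  by exists M => _ [N _ <-]; exact: xM.
have e2 : 0 < e / 2 by rewrite divr_gt0.
move/cvg_ex : cS => [l /cvgrPdist_lt /(_ _ e2)[N _ NP]]; exists N.
have xS m n : (m <= n)%N -> rnorm (x n - x m) <= S n - S m.
  elim: n => [|n IH]; first by rewrite leqn0 => /eqP ->; rewrite !subrr rnorm0.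
  rewrite leq_eqVlt => /predU1P[->|mn]; first by rewrite !subrr rnorm0.
  have := rnormD (x n.+1 - x n) (x n - x m); rewrite addrA subrK.
  by move/le_trans; apply;
    rewrite {1}/S big_ord_recr/= -/(S n) addrAC addrC lerD// IH.
have SN m n : (N <= m)%N -> (N <= n)%N -> S n - S m < e.
  move=> Nm Nn; have := NP _ Nm; have := NP _ Nn.
  by rewrite !ltr_norml /= => /andP[? ?] /andP[? ?]; lra.
move=> m n Nm Nn; have [mn|/ltnW nm] := leqP m n.
  by rewrite rnormBC (le_lt_trans (xS _ _ mn))// SN.
by rewrite (le_lt_trans (xS _ _ nm))// SN.
Qed.

Lemma sum_geom_half N : \sum_(k < N) (2^-1 : R) ^+ k <= 2.
Proof.
suff -> : \sum_(k < N) (2^-1 : R) ^+ k = 2 - 2 * 2^-1 ^+ N.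
  by rewrite gerBl mulr_ge0// exprn_ge0.
elim: N => [|N IH]; first by rewrite big_ord0 expr0 mulr1 subrr.
by rewrite big_ord_recr/= IH exprS; field.
Qed.

(** The limit is constructed along simple functions [g k] at distance less than
    [2^-k] from the terms [u (N k)] of a fast subsequence: this makes it
    strongly measurable at once. If [D] is the norm of [g (k+1) - g k] at a
    point, the inequality [D <= 2^-k + 2^k D^2] reduces absolute convergence at
    almost every point to the summability of the integrals of [2^k D^2];
    Fatou's lemma then bounds the distance from [g k] to the limit. *)
Lemma riesz_fischer (u : nat -> T -> V) : seq_complete V ->
  (forall n, L2 (u n)) ->
  (forall e, 0 < e -> exists N, forall m n, (N <= m)%N -> (N <= n)%N ->
    L2sq (fun t => u m t - u n t) < e) ->
  exists2 v, L2 v & L2sq (fun t => u n t - v t) @[n --> \oo] --> (0 : R).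
Proof.
move=> cV lu uc; pose q k := (2^-1 : R) ^+ k.
have q0 k : 0 < q k by rewrite exprn_gt0.
have /all_sig[N NP] : forall k, {N | forall m n, (N <= m)%N -> (N <= n)%N ->
    L2sq (fun t => u m t - u n t) < q k ^+ 2}.
  by move=> k; apply: cid; apply: uc; rewrite exprn_gt0.
have /all_sig2[g sg gP] : forall k, {g | simple_fun mu g &
    L2sq (fun t => u (N k) t - g t) < q k ^+ 2}.
  by move=> k; apply: cid2; apply: L2_dense; rewrite ?exprn_gt0.
have lg k := L2_simple (sg k).
have qle k l : (k <= l)%N -> q l <= q k.
  by move=> kl; apply: ler_wiXn2l => //; lra.
(* two triangle inequalities, each doubling the squared norms *)
have ug k n : (N k <= n)%N -> L2sq (fun t => u n t - g k t) <= 4 * q k ^+ 2.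
  move=> Nn; apply: (le_trans (L2sq_triangle (lu n) (lu (N k)) (lg k))).
  have := NP k n (N k) Nn (leqnn _); have := gP k; lra.
have gg k l : (k <= l)%N -> L2sq (fun t => g l t - g k t) <= 16 * q k ^+ 2.
  move=> kl; pose n := maxn (N k) (N l).
  apply: (le_trans (L2sq_triangle (lg l) (lu n) (lg k))).
  have := ug k n (leq_maxl _ _); have := ug l n (leq_maxr _ _).
  have : q l ^+ 2 <= q k ^+ 2 by rewrite lerXn2r ?nnegrE ?(ltW (q0 _))// qle.
  rewrite L2sqC; lra.
have aeg : \forall t \ae mu, exists l : V, g ^~ t @ \oo --> l.
  have iD k := (L2_B (lg k.+1) (lg k)).2.
  have ih k := ae_integrableZ (q k)^-1 (iD k).
  have aeB := ae_beppo_levi (C := 32) ih.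
  have {}aeB : \forall t \ae mu, exists M, forall n,
      \sum_(k < n) (q k)^-1 * rnorm (g k.+1 t - g k t) ^+ 2 <= M.
    apply: aeB => [k t|M].
      by apply: mulr_ge0; [rewrite invr_ge0 ltW|exact: rnorm_sqr_ge0].
    apply: (@le_trans _ _ (\sum_(k < M) 16 * q k)); last first.
      by rewrite -mulr_sumr; have := sum_geom_half M; rewrite -/q; lra.
    apply: ler_sum => k _;
      rewrite Rintegral_aeZ// mulrC ler_pdivrMr// -mulrA -expr2.
    exact: gg.
  apply: filterS aeB => t [M tM].
  apply: (@bounded_variation_cvg _ (2 + M)) => // n.
  apply: (@le_trans _ _
    (\sum_(k < n) (q k + (q k)^-1 * rnorm (g k.+1 t - g k t) ^+ 2))).
    apply: ler_sum => k _; set D := rnorm _.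
    rewrite -(ler_pM2l (q0 k)) mulrDr mulrA divff ?mul1r ?gt_eqF//.
    by have := q0 k; have : 0 <= D := rnorm_ge0 _; nra.
  by rewrite big_split/=; apply: lerD; [exact: sum_geom_half|exact: tM].
pose v t := xget 0 [set l : V | g ^~ t @ \oo --> l].
have gv : \forall t \ae mu, g ^~ t @ \oo --> v t.
  by apply: filterS aeg => t tl;
    exact: (@xgetPex V 0 [set l : V | g ^~ t @ \oo --> l]).
have sv : strongly_measurable mu v by exists g.
have vg k :
  L2 (fun t => v t - g k t) /\ L2sq (fun t => v t - g k t) <= 16 * q k ^+ 2.
  have lB l := L2_B (lg (l + k)%N) (lg k).
  have [||||iv Iv] := ae_fatou (C := 16 * q k ^+ 2)
    (h := fun t => rnorm (v t - g k t) ^+ 2) (fun l => (lB l).2).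
  - by move=> n t; exact: rnorm_sqr_ge0.
  - by move=> t; exact: rnorm_sqr_ge0.
  - apply: filterS gv => t gvt; apply/cvg_pow/cvg_rnorm_of.
    by apply: cvgB; [rewrite (cvg_shiftn k (g ^~ t))|exact: cvg_cst].
  - by move=> n; apply: gg; rewrite leq_addl.
  by split => //; split => //; apply: sm_B => //; exact: (lg k).1.
have lv : L2 v.
  have := L2_D (vg 0%N).1 (lg 0%N).
  by apply: L2_ae; apply: nearW => t; rewrite subrK.
exists v => //; apply/cvgrPdist_le => e e0.
(* 40 = 2 * 4 + 2 * 16, the constants of [ug] and [vg] *)
have [k ke] : exists k, q k < e / 40.
  have h1 : `|2^-1 : R| < 1 by rewrite ger0_norm//; lra.
  have e40 : 0 < e / 40 by rewrite divr_gt0.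
  have /cvgrPdist_lt /(_ _ e40)[N0 _ /(_ N0 (leqnn _))] := cvg_expr h1.
  by rewrite /= sub0r normrN ger0_norm => [|]; [exists N0|exact/ltW/q0].
exists (N k) => // n /= Nn; rewrite sub0r normrN ger0_norm ?L2sq_ge0//.
apply: (le_trans (L2sq_triangle (lu n) (lg k) lv)).
have := ug k n Nn; have [_] := vg k; rewrite (L2sqC v).
have qk1 : q k <= 1 by rewrite /q exprn_ile1//; lra.
have := q0 k; nra.
Qed.

End one_space.
End L2_theory.

(** * The inner product of L^2(T; V)^m *)

Section rdot_theory.
Context {R : realType} {s : scalar_kind} {V : sep_hilbert R s}.
Local Notation K := (scalars R s).
Local Notation conj := (@scalar_conj R s).
Let hV : real_ip rdot := rdot_ip V.

Lemma rdot_cvg (u v : nat -> V) (x y : V) : u @ \oo --> x -> v @ \oo --> y ->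
  (fun n => rdot (u n) (v n)) @ \oo --> rdot x y.
Proof.
move=> ux vy; apply/subr_cvg0/norm_cvg0P.
apply: (@squeeze_cvgr _ _ _ _ (fun=> 0)
  (fun n => rnorm (u n - x) * rnorm (v n) + rnorm x * rnorm (v n - y))).
- apply: nearW => n; rewrite normr_ge0/=.
  rewrite (_ :
    rdot (u n) (v n) - rdot x y = rdot (u n - x) (v n) + rdot x (v n - y)).
    by rewrite (le_trans (ler_normD _ _))// lerD// ip_cauchy_schwarz.
  by rewrite (ipBl hV) (ipBr hV) addrA subrK.
- exact: cvg_cst.
- suff : rnorm (u n - x) * rnorm (v n) + rnorm x * rnorm (v n - y) @[n --> \oo]
      --> 0 * rnorm y + rnorm x * 0 by rewrite mul0r mulr0 addr0.
  apply: cvgD; first by apply: cvgM; [exact/cvg_rnorm|exact: cvg_rnorm_of].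
  by apply: cvgM; [exact: cvg_cst|exact/cvg_rnorm].
Qed.

Lemma rdotZC (h : K) (x v : V) : rdot x (conj h *: v) = rdot (h *: x) v.
Proof. by rewrite /rdot dotZr conjK dotZl. Qed.

End rdot_theory.

Section L2_inner_product.
Context {R : realType} {s : scalar_kind} {d : measure_display}
  {T : measurableType d} (mu : {measure set T -> \bar R}) {V : sep_hilbert R s}
  {m : nat}.
Local Notation K := (scalars R s).
Local Notation I h := (Rintegral mu setT h).
Local Notation conj := (@scalar_conj R s).
Implicit Types (g u c : 'I_m -> T -> V) (h : 'I_m -> T -> K).
Let hV : real_ip rdot := rdot_ip V.

Lemma ae_integrable_rdot (f g : T -> V) : L2 mu f -> L2 mu g ->
  ae_integrable mu (fun t => rdot (f t) (g t)).
Proof.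
move=> [sf iff] [sg ig].
apply: (ae_integrable_dom (sm_real2 (phi := rdot) _ sf sg)
  (ae_integrableD iff ig)).
  by move=> *; exact: rdot_cvg.
apply: nearW => t; apply: (le_trans (ip_cauchy_schwarz hV _ _)).
have := rnorm_ge0 (f t); have := rnorm_ge0 (g t).
have := sqr_ge0 (rnorm (f t) - rnorm (g t)); nra.
Qed.

Definition L2tuple (W : normedModType K) (g : 'I_m -> T -> W) :=
  forall j, L2 mu (g j).

(** The real inner product of [L^2(T; V)^m]. Complex orthogonality relations
    are recovered from it by testing with all multiples [c *: v] of a vector.
    *)
Definition L2dot g u := I (fun t => \sum_(j < m) rdot (g j t) (u j t)).

Lemma L2dot_sum g u : L2tuple g -> L2tuple u ->
  ae_integrable mu (fun t => \sum_(j < m) rdot (g j t) (u j t)) /\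
  L2dot g u = \sum_(j < m) I (fun t => rdot (g j t) (u j t)).
Proof.
by move=> lg lu; apply: Rintegral_ae_sum => j _; exact: ae_integrable_rdot.
Qed.

Lemma L2dot_sqr g : L2tuple g -> L2dot g g = \sum_(j < m) L2sq mu (g j).
Proof.
move=> lg; rewrite (L2dot_sum lg lg).2; apply: eq_bigr => j _.
by apply: eq_Rintegral => t _; rewrite (ip_sqr hV).
Qed.

Lemma L2dotC g u : L2dot g u = L2dot u g.
Proof.
by apply: eq_Rintegral => t _; apply: eq_bigr => j _; rewrite (ipC hV).
Qed.

Lemma L2dot_ge0 g : 0 <= L2dot g g.
Proof.
apply: Rintegral_ge0T => t; apply: sumr_ge0 => j _.
by rewrite (ip_sqr hV) rnorm_sqr_ge0.
Qed.

Lemma L2dotDl g u c : L2tuple g -> L2tuple u -> L2tuple c ->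
  L2dot (fun j t => g j t + u j t) c = L2dot g c + L2dot u c.
Proof.
move=> lg lu lc; rewrite /L2dot -Rintegral_aeD;
  [|exact: (L2dot_sum lg lc).1|exact: (L2dot_sum lu lc).1].
apply: eq_Rintegral => t _; rewrite -big_split; apply: eq_bigr => j _.
by rewrite (ipDl hV).
Qed.

Lemma L2dotZl a g c : L2tuple g -> L2tuple c ->
  L2dot (fun j t => of_real s a *: g j t) c = a * L2dot g c.
Proof.
move=> lg lc; rewrite /L2dot -Rintegral_aeZ; last exact: (L2dot_sum lg lc).1.
apply: eq_Rintegral => t _; rewrite mulr_sumr; apply: eq_bigr => j _.
by rewrite (ipZl hV).
Qed.

Lemma L2dotBl g u c : L2tuple g -> L2tuple u -> L2tuple c ->
  L2dot (fun j t => g j t - u j t) c = L2dot g c - L2dot u c.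
Proof.
move=> lg lu lc; rewrite /L2dot -Rintegral_aeB;
  [|exact: (L2dot_sum lg lc).1|exact: (L2dot_sum lu lc).1].
apply: eq_Rintegral => t _; rewrite -sumrB; apply: eq_bigr => j _.
by rewrite (ipBl hV).
Qed.

Lemma L2tupleB g u : L2tuple g -> L2tuple u ->
  L2tuple (fun j t => g j t - u j t).
Proof. by move=> lg lu j; exact: L2_B. Qed.

Lemma L2_scale (a : K) (f : T -> V) : L2 mu f -> L2 mu (fun t => a *: f t).
Proof.
move=> [sf iff]; split.
  apply: (sm_op1 (op := fun x => a *: x) _ _ sf); first by rewrite scaler0.
  by move=> u x ux; apply: cvgZ => //; exact: cvg_cst.
apply: eq_ae_integrable (ae_integrableZ ((re `|a|) ^+ 2) iff);
  apply: nearW => t.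
by rewrite rnormZ exprMn.
Qed.

Lemma L2dot_sqrB g u : L2tuple g -> L2tuple u ->
  L2dot (fun j t => g j t - u j t) (fun j t => g j t - u j t) =
  L2dot g g - 2 * L2dot g u + L2dot u u.
Proof.
move=> lg lu; have lB := L2tupleB lg lu.
rewrite (L2dotBl lg lu lB) ![L2dot _ (fun j t => g j t - u j t)]L2dotC.
by rewrite !(L2dotBl lg lu)// (L2dotC u g); ring.
Qed.

(** The quadratic polynomial [a |-> |g - a u|^2] is nonnegative. *)
Lemma L2dot_cauchy_schwarz g u : L2tuple g -> L2tuple u ->
  L2dot g u ^+ 2 <= L2dot g g * L2dot u u.
Proof.
move=> lg lu.
have pos a : 0 <= L2dot g g - 2 * a * L2dot g u + a ^+ 2 * L2dot u u.
  have lau : L2tuple (fun j t => of_real s a *: u j t) by move=> j;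
    exact: L2_scale.
  have := L2dot_ge0 (fun j t => g j t - of_real s a *: u j t).
  rewrite L2dot_sqrB// (L2dotC g (fun j t => of_real s a *: u j t)) L2dotZl//
    (L2dotZl _ lu lau).
  by rewrite (L2dotC u (fun j t => of_real s a *: u j t)) L2dotZl//
    (L2dotC u g); lra.
have u0 := L2dot_ge0 u.
move: pos u0 (L2dot_ge0 g); set A := L2dot g g; set B := L2dot g u;
  set C := L2dot u u => pos C0 A0.
have [C00|Cn0] := eqVneq C 0.
  have [->|Bn0] := eqVneq B 0; first by rewrite expr0n mulr_ge0.
  have := pos ((A + 1) / (2 * B)); rewrite C00.
  rewrite (_ : 2 * ((A + 1) / (2 * B)) * B = A + 1); last by field.
  by rewrite mulr0; lra.
have := pos (B / C).
rewrite (_ : _ + _ = A - B ^+ 2 / C); last by field.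
by rewrite subr_ge0 ler_pdivrMr// lt_neqAle eq_sym Cn0.
Qed.

Lemma sm_Z (h : T -> K) (f : T -> V) :
  strongly_measurable mu (h : T -> K^o) -> strongly_measurable mu f ->
  strongly_measurable mu (fun t => h t *: f t).
Proof.
move=> sh sf; apply: (sm_op2 (V1 := K^o) (op := fun a x => a *: x) _ _ sh sf).
  by rewrite scaler0.
by move=> u v x y; exact: cvgZ.
Qed.

Lemma bochner_integrableZ (h : T -> K) (f : T -> V) : L2 mu (h : T -> K^o) ->
  L2 mu f ->
  bochner_integrable mu (fun t => h t *: f t).
Proof.
move=> [sh ih] [sf iff]; have sZ := sm_Z sh sf; split => //.
apply: (ae_integrable_dom _ (ae_integrableD ih iff)).
  by apply: eq_ae_measurable (sm_rnorm 1 sZ); apply: nearW => t; rewrite expr1.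
apply: nearW => t; rewrite ger0_norm ?rnorm_ge0// rnormZ -/(rnorm (h t : K^o)).
have := rnorm_ge0 (h t : K^o); have := rnorm_ge0 (f t).
have := sqr_ge0 (rnorm (h t : K^o) - rnorm (f t)); nra.
Qed.

Lemma L2_conj (h : T -> K) : L2 mu (h : T -> K^o) ->
  L2 mu ((fun t => conj (h t)) : T -> K^o).
Proof.
move=> [sh ih]; split.
  apply: (sm_op1 (V1 := K^o) (V2 := K^o) (op := conj) _ _ sh);
    first exact: conj0.
  move=> u x /cvg_rnorm ux; apply/cvg_rnorm.
  rewrite (_ : (fun _ => _) = (fun n => rnorm (u n - x)))//.
  by apply/funext => n; rewrite -conjB rnorm_conj.
apply: eq_ae_integrable ih; apply: nearW => t; by rewrite rnorm_conj.
Qed.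

Lemma L2_Zv (h : T -> K) (v : V) : L2 mu (h : T -> K^o) ->
  L2 mu (fun t => h t *: v).
Proof.
move=> [sh ih]; split.
  apply: (sm_op1 (V1 := K^o) (op := fun a => a *: v) _ _ sh);
    first exact: scale0r.
  by move=> u x ux; apply: cvgZ => //; exact: cvg_cst.
apply: eq_ae_integrable (ae_integrableZ (rnorm v ^+ 2) ih); apply: nearW => t.
by rewrite rnormZ exprMn mulrC.
Qed.

Lemma L2tuple_conjZ h (v : V) : @L2tuple K^o h ->
  L2tuple (fun j t => conj (h j t) *: v).
Proof. by move=> lh j; apply: L2_Zv; exact: L2_conj. Qed.

(** The functions [conj(h) v] represent the matrix coefficients of the POD
    operator of [g]. *)
Lemma L2dot_pod g h v : L2tuple g -> @L2tuple K^o h ->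
  L2dot g (fun j t => conj (h j t) *: v) = rdot (pod_op mu g h) v.
Proof.
move=> lg lh; rewrite (L2dot_sum lg (L2tuple_conjZ v lh)).2.
rewrite /pod_op (real_form_sum _ _ _ (ip_form hV v)); apply: eq_bigr => j _.
rewrite (bochner_form hV _ (ip_form hV v) (ip_bounded hV v)).
- by apply: eq_Rintegral => t _; rewrite rdotZC.
- exact: complete_seq_complete.
- exact: bochner_integrableZ.
Qed.

Lemma bochner_integrableM (h k : T -> K) : L2 mu (h : T -> K^o) ->
  L2 mu (k : T -> K^o) ->
  bochner_integrable mu ((fun t => h t * k t) : T -> K^o).
Proof.
move=> [sh ih] [sk ik].
have sM : strongly_measurable mu ((fun t => h t * k t) : T -> K^o).
  apply: (sm_op2 (V1 := K^o) (V2 := K^o) (V3 := K^o) (op := fun x y => x * y)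
    _ _ sh sk).
    by rewrite mulr0.
  by move=> u v x y; exact: cvgM.
split => //; apply: (ae_integrable_dom _ (ae_integrableD ih ik)).
  by apply: eq_ae_measurable (sm_rnorm 1 sM); apply: nearW => t; rewrite expr1.
apply: nearW => t; rewrite ger0_norm ?rnorm_ge0// rnorm_mul.
have := rnorm_ge0 (h t : K^o); have := rnorm_ge0 (k t : K^o).
have := sqr_ge0 (rnorm (h t : K^o) - rnorm (k t : K^o)); nra.
Qed.

Lemma re_dotS h h' (c : K) : @L2tuple K^o h -> @L2tuple K^o h' ->
  re (dotS mu h h' * c) =
  I (fun t => \sum_(j < m) re (h j t * conj (h' j t) * c)).
Proof.
move=> lh lh'.
pose l (z : K^o) := re (z * c).
have rl : real_form l.
  split => [x y|a x]; rewrite /l ?mulrDl ?reD//.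
  by rewrite -re_ofRM mulrA.
have bl : bounded_form l.
  exists (rnorm (c : K^o)) => x; rewrite /l mulrC -rnorm_mul mulrC.
  exact: re_le_norm.
have si j : bochner_integrable mu ((fun t => h j t * conj (h' j t)) : T -> K^o).
  by apply: bochner_integrableM => //; exact: L2_conj.
have [_ ->] := Rintegral_ae_sum (index_enum 'I_m) (P := xpredT)
  (fun j _ => ae_integrable_form rl bl (si j)).
rewrite /dotS -[LHS]/(l _) (real_form_sum _ _ _ rl); apply: eq_bigr => j _.
exact: (bochner_form scalar_dot_ip (@scalar_complete R s) rl bl (si j)).
Qed.

(** The orthogonality of the right singular functions [f_k] becomes the
    orthogonality of the functions [conj(f_k) v_k]. *)
Lemma L2dot_conj h h' (v v' : V) : @L2tuple K^o h -> @L2tuple K^o h' ->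
  L2dot (fun j t => conj (h j t) *: v) (fun j t => conj (h' j t) *: v') =
  re (dotS mu h' h * dotH V v v').
Proof.
move=> lh lh'; rewrite re_dotS//.
apply: eq_Rintegral => t _; apply: eq_bigr => j _.
by rewrite rdotZC /rdot scalerA dotZl.
Qed.

End L2_inner_product.

(** * The Hilbert-Schmidt identity *)

Lemma sep_hilbert_seq (R : realType) (s : scalar_kind) (V : sep_hilbert R s) :
  exists q : nat -> V, forall x (e : R), 0 < e -> exists n, rnorm (x - q n) < e.
Proof.
have [D cD dD] := separableH V.
have ball_ne (x : V) (e : R) : 0 < e -> exists y, D y /\ rnorm (x - y) < e.
  move=> e0; have e0' :
    0 < of_real s e by rewrite -[X in X < _](ofR0 (R := R)) ofR_lt.
  have [||y [xy Dy]] := dD (ball x (of_real s e)).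
  - by exists x; exact: ballxx.
  - exact: ball_open.
  exists y; split => //; move: xy; rewrite -ball_normE /= normE ofR_lt.
  by [].
have /pfcard_geP[D0|[f]] := cD.
  by have [y []] := ball_ne 0 1 ltr01; rewrite D0.
exists f => x e e0; have [y [Dy xy]] := ball_ne x e e0.
have [n _ fn] := @surj _ _ _ _ f y Dy.
by exists n; rewrite fn.
Qed.

Lemma cvg_sum0 (R : realType) (J : Type) (r : seq J) (f : J -> nat -> R) :
  (forall j, f j @ \oo --> (0 : R)) ->
    \sum_(j <- r) f j n @[n --> \oo] --> (0 : R).
Proof.
move=> f0; elim: r => [|j r IH].
  by under eq_fun do rewrite big_nil; exact: cvg_cst.
under eq_fun do rewrite big_cons.
suff : f j n + \sum_(i <- r) f i n @[n --> \oo] --> 0 + (0 : R)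
  by rewrite addr0.
exact: cvgD.
Qed.

Section dot_L2.
Context {R : realType} {s : scalar_kind} {d : measure_display}
  {T : measurableType d} (mu : {measure set T -> \bar R}) {V : sep_hilbert R s}.
Local Notation K := (scalars R s).

(** Multiplying [x] by the conjugate of [(x, y)] makes the inner product real
    and reduces the claim to the real Cauchy-Schwarz inequality. *)
Lemma dot_cauchy_schwarz (x y : V) :
  rnorm (dotH V x y : K^o) <= rnorm x * rnorm y.
Proof.
set c := dotH V x y.
have [->|c0] := eqVneq (rnorm (c : K^o)) 0;
  first by rewrite mulr_ge0 ?rnorm_ge0.
have cp : 0 < rnorm (c : K^o) by rewrite lt_neqAle eq_sym c0 rnorm_ge0.
rewrite -(ler_pM2l cp) -expr2.
have -> : rnorm (c : K^o) ^+ 2 = rdot (scalar_conj c *: x) y.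
  by rewrite /rdot dotZl mulrC mul_conj [in RHS]normE -ofRX re_ofR.
rewrite (le_trans (ler_norm _))//
  (le_trans (ip_cauchy_schwarz (rdot_ip V) _ _))//.
by rewrite rnormZ -/(rnorm (scalar_conj c : K^o)) rnorm_conj mulrA.
Qed.

Lemma L2_dot (y : V) (f : T -> V) : L2 mu f ->
  L2 mu ((fun t => dotH V (f t) y) : T -> K^o).
Proof.
move=> [sf iff].
have sd : strongly_measurable mu ((fun t => dotH V (f t) y) : T -> K^o).
  apply: (sm_op1 (V2 := K^o) (op := fun x => dotH V x y) _ _ sf).
    exact: dot0l.
  move=> u x /cvg_rnorm ux; apply/cvg_rnorm.
  apply: (@squeeze_cvgr _ _ _ _ (fun=> 0) (fun n => rnorm (u n - x) * rnorm y)).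
  - by apply: nearW => n; rewrite rnorm_ge0/= -dotBl dot_cauchy_schwarz.
  - exact: cvg_cst.
  - by rewrite -[X in _ --> X](mul0r (rnorm y)); apply: cvgM => //;
      exact: cvg_cst.
split => //;
  apply: (ae_integrable_dom (sm_rnorm 2 sd)
  (ae_integrableZ (rnorm y ^+ 2) iff)).
apply: nearW => t; rewrite ger0_norm ?rnorm_sqr_ge0// -exprMn mulrC.
by rewrite lerXn2r ?nnegrE ?mulr_ge0 ?rnorm_ge0// dot_cauchy_schwarz.
Qed.

End dot_L2.

Section hilbert_schmidt.
Context {R : realType} {s : scalar_kind} {d : measure_display}
  {T : measurableType d} (mu : {measure set T -> \bar R}) {V : sep_hilbert R s}
  {m : nat}.
Local Notation K := (scalars R s).
Local Notation conj := (@scalar_conj R s).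
Local Notation dd := (L2dot mu).
Let hV : real_ip rdot := rdot_ip V.

(** Outside one null set, [z j t] is orthogonal to all points of a dense
    sequence, hence to itself. *)
Lemma L2dot_eq0 (z : 'I_m -> T -> V) : L2tuple mu z ->
  (forall v, \forall t \ae mu, forall j, dotH V (z j t) v = 0) -> dd z z = 0.
Proof.
move=> lz zv; have [q qd] := sep_hilbert_seq V.
have aez : \forall t \ae mu, forall n j, dotH V (z j t) (q n) = 0.
  by apply: ae_foralln => n; exact: zv.
rewrite /L2dot (@Rintegral_ae _ _ _ _ _ (fun=> 0)).
  by rewrite /Rintegral integral0.
apply: filterS aez => t zt; apply: big1 => j _.
rewrite (ip_sqr hV); suff -> : rnorm (z j t) = 0 by rewrite expr0n.
apply/eqP; rewrite eq_le rnorm_ge0 andbT; apply/ler_addgt0Pr => e e0.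
rewrite add0r; have [n zq] := qd (z j t) e e0.
have [->|z0] := eqVneq (rnorm (z j t)) 0; first exact: ltW.
have zp : 0 < rnorm (z j t) by rewrite lt_neqAle eq_sym z0 rnorm_ge0.
rewrite -(ler_pM2l zp) -expr2 -(ip_sqr hV).
have -> : rdot (z j t) (z j t) = rdot (z j t) (z j t - q n).
  by rewrite (ipBr hV) {3}/rdot zt re0 subr0.
by rewrite (le_trans (ler_norm _))//
  (le_trans (ip_cauchy_schwarz hV _ _))// ler_wpM2l ?ltW.
Qed.

Variables (g : 'I_m -> T -> V) (e : nat -> 'I_m -> T -> K) (P : pred nat).
Hypotheses (lg : L2tuple mu g)
  (l2e : forall k, P k -> @L2tuple R s _ _ mu m K^o (e k))
  (orth : forall k l, P k -> P l -> dotS mu (e k) (e l) = (k == l)%:R)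
  (hker : forall h, @L2tuple R s _ _ mu m K^o h ->
    (forall k, P k -> dotS mu h (e k) = 0) -> pod_op mu g h = 0).

(* Replacing [e k] by 0 outside [P] lets all the sums below run over every
   index. *)
Let a k : V := if P k then pod_op mu g (e k) else 0.
Let e' k : 'I_m -> T -> K := if P k then e k else fun _ _ => 0.
Let b k : 'I_m -> T -> V := fun j t => conj (e' k j t) *: a k.
Let u n : 'I_m -> T -> V := fun j t => \sum_(k < n) b k j t.
Let S n : R := \sum_(k < n) rnorm (a k) ^+ 2.

Let le' k : @L2tuple R s _ _ mu m K^o (e' k).
Proof. by rewrite /e'; case: ifPn => [/l2e//|_ j]; exact: L2_0. Qed.

Let lb k : L2tuple mu (b k).
Proof. exact: L2tuple_conjZ. Qed.

Let uS n j t : u n.+1 j t = u n j t + b n j t.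
Proof. by rewrite /u big_ord_recr. Qed.

Let u0 j t : u 0 j t = 0.
Proof. by rewrite /u big_ord0. Qed.

Let lu n : L2tuple mu (u n).
Proof.
elim: n => [|n IH] j.
  by apply: L2_ae (L2_0 mu); apply: nearW => t; rewrite u0.
by apply: L2_ae (L2_D (IH j) (lb n j)); apply: nearW => t; rewrite uS.
Qed.

Let dd_u0 c : dd (u 0) c = 0.
Proof.
rewrite /L2dot; under eq_Rintegral do under eq_bigr do rewrite u0 (ip0l hV).
by under eq_Rintegral do rewrite big1//; rewrite /Rintegral integral0.
Qed.

Let dd_uS n c : L2tuple mu c -> dd (u n.+1) c = dd (u n) c + dd (b n) c.
Proof.
move=> lc; rewrite -L2dotDl//; congr Rintegral; apply/funext => t.
by apply: eq_bigr => j _; rewrite uS.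
Qed.

Let dd_bv k l (v : V) : P k ->
  dd (b l) (fun j t => conj (e' k j t) *: v) = (l == k)%:R * rdot (a l) v.
Proof.
move=> Pk; rewrite /b L2dot_conj// /e' /a Pk; case: ifPn => Pl.
  rewrite orth// eq_sym; have [->|_] := eqVneq l k.
    by rewrite !mul1r.
  by rewrite !mul0r re0.
by rewrite dot0l mulr0 (ip0l hV) mulr0 re0.
Qed.

Let dd_bb k l : dd (b l) (b k) = (l == k)%:R * rnorm (a l) ^+ 2.
Proof.
have [Pk|Pk] := boolP (P k).
  rewrite dd_bv//; have [->|_] := eqVneq l k; last by rewrite !mul0r.
  by rewrite (ip_sqr hV).
have ak : a k = 0 by rewrite /a (negbTE Pk).
rewrite {2}/b /b L2dot_conj// ak; have [->|_] := eqVneq l k.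
  by rewrite ak dot0l mulr0 re0 rnorm0 expr0n mulr0.
by rewrite dotC dot0l conj0 mulr0 re0 mul0r.
Qed.

Let dd_ub n l : dd (u n) (b l) = (l < n)%:R * rnorm (a l) ^+ 2.
Proof.
elim: n => [|n IH]; first by rewrite dd_u0 ltn0 mul0r.
rewrite dd_uS// IH dd_bb (ltnS l n) (leq_eqVlt l n) (eq_sym l).
have [->|_] := eqVneq n l; first by rewrite ltnn mul0r add0r.
by rewrite mul0r addr0.
Qed.

Let dd_uv n k (v : V) : P k -> (k < n)%N ->
  dd (u n) (fun j t => conj (e' k j t) *: v) = rdot (a k) v.
Proof.
move=> Pk; elim: n => // n IH; rewrite ltnS leq_eqVlt.
have lc : L2tuple mu (fun j t => conj (e' k j t) *: v) by exact: L2tuple_conjZ.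
have big l : (l <= k)%N -> dd (u l) (fun j t => conj (e' k j t) *: v) = 0.
  elim: l => [|l IHl] lk; first by rewrite dd_u0.
  by rewrite dd_uS// IHl 1?ltnW// dd_bv// add0r lt_eqF// mul0r.
rewrite dd_uS// dd_bv// => /predU1P[<-|kn].
  by rewrite big// eqxx mul1r add0r.
by rewrite IH// gt_eqF// mul0r addr0.
Qed.

Let dd_gb k : dd g (b k) = rnorm (a k) ^+ 2.
Proof.
rewrite /b L2dot_pod// /e' /a; case: ifPn => Pk; first by rewrite (ip_sqr hV).
by rewrite (ip0r hV) rnorm0 expr0n.
Qed.

Let SS n : S n.+1 = S n + rnorm (a n) ^+ 2.
Proof. by rewrite /S big_ord_recr. Qed.

Let dd_gu n : dd g (u n) = S n.
Proof.
rewrite L2dotC; elim: n => [|n IH]; first by rewrite dd_u0 /S big_ord0.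
by rewrite dd_uS// IH L2dotC dd_gb SS.
Qed.

Let dd_uu n p : (n <= p)%N -> dd (u n) (u p) = S n.
Proof.
move=> np; rewrite L2dotC; have dpn := dd_ub p.
elim: n np => [|n IH] np; first by rewrite L2dotC dd_u0 /S big_ord0.
by rewrite L2dotC dd_uS// L2dotC IH 1?ltnW// L2dotC dpn np mul1r SS.
Qed.

Let dd_uB n p : (n <= p)%N ->
  dd (fun j t => u p j t - u n j t) (fun j t => u p j t - u n j t) = S p - S n.
Proof.
by move=> np; rewrite L2dot_sqrB// dd_uu// (L2dotC mu (u p)) !dd_uu//; ring.
Qed.

(* [u n] is the orthogonal projection of [g] onto the span of the [b k],
   [k < n]. *)
Let dd_gBu n :
  dd (fun j t => g j t - u n j t) (fun j t => g j t - u n j t) = dd g g - S n.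
Proof. by rewrite L2dot_sqrB// dd_gu dd_uu//; ring. Qed.

Let ndS : nondecreasing_seq S.
Proof. by apply/nondecreasing_seqP => n; rewrite SS lerDl rnorm_sqr_ge0. Qed.

Let S_le n : S n <= dd g g.
Proof. by rewrite -subr_ge0 -dd_gBu L2dot_ge0. Qed.

Let S_cauchy x : 0 < x -> exists N, forall p n, (N <= n)%N -> (n <= p)%N ->
  S p - S n < x.
Proof.
move=> x0; have cS : cvgn S.
  by apply: nondecreasing_is_cvgn => //; exists (dd g g) => _ [n _ <-].
have x2 : 0 < x / 2 by rewrite divr_gt0.
move/cvg_ex : cS => [l /cvgrPdist_lt /(_ _ x2)[N _ NP]]; exists N => p n Nn np.
have := NP _ Nn; have := NP _ (leq_trans Nn np).
by rewrite /= !ltr_norml => /andP[? ?] /andP[? ?]; lra.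
Qed.

Let u_lim : exists2 v, L2tuple mu v &
  dd (fun j t => u n j t - v j t) (fun j t => u n j t - v j t)
    @[n --> \oo] --> (0 : R).
Proof.
have ex j : exists2 v, L2 mu v &
    L2sq mu (fun t => u n j t - v t) @[n --> \oo] --> (0 : R).
  apply: riesz_fischer; first exact: complete_seq_complete.
    by move=> n; exact: lu.
  move=> x x0; have [N NP] := S_cauchy x0; exists N.
  have wl p n : (N <= n)%N -> (n <= p)%N ->
      L2sq mu (fun t => u p j t - u n j t) < x.
    move=> Nn np; apply: le_lt_trans (NP p n Nn np).
    rewrite -dd_uB// L2dot_sqr; last exact: L2tupleB.
    by rewrite (bigD1 j)//= lerDl sumr_ge0// => i _; exact: L2sq_ge0.
  move=> p n Np Nn; have [np|/ltnW pn] := leqP n p; first exact: wl.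
  by rewrite L2sqC; exact: wl.
have /all_sig2[v lv vP] : forall j, {v | L2 mu v &
    L2sq mu (fun t => u n j t - v t) @[n --> \oo] --> (0 : R)}.
  by move=> j; apply: cid2; exact: ex.
exists v => //.
rewrite (_ :
  (fun n => _) = (fun n => \sum_(j < m) L2sq mu (fun t => u n j t - v j t))).
  by apply: cvg_sum0 => j; exact: vP.
by apply/funext => n; rewrite L2dot_sqr//; exact: L2tupleB.
Qed.

(** The Hilbert-Schmidt identity: the limit is the squared norm of the data
    [g], the terms are the squared norms of the values of its POD operator on
    an orthonormal family whose orthogonal complement it annihilates. *)
Theorem pod_sum_sqr_cvg : S @ \oo --> \sum_(j < m) L2sq mu (g j).
Proof.
have [v lv uv] := u_lim; pose z : 'I_m -> T -> V := fun j t => g j t - v j t.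
have lz : L2tuple mu z by exact: L2tupleB.
have ddv c : L2tuple mu c -> dd (u n) c @[n --> \oo] --> dd v c.
  move=> lc; apply/subr_cvg0/norm_cvg0P.
  have sq0 : (dd (u n) c - dd v c) ^+ 2 @[n --> \oo] --> (0 : R).
    apply: (@squeeze_cvgr _ _ _ _ (fun=> 0) (fun n =>
      dd (fun j t => u n j t - v j t) (fun j t => u n j t - v j t) * dd c c)).
    - apply: nearW => n; rewrite sqr_ge0/= -L2dotBl// L2dot_cauchy_schwarz//;
        exact: L2tupleB.
    - exact: cvg_cst.
    - by rewrite -[X in _ --> X](mul0r (dd c c)); apply: cvgM => //;
        exact: cvg_cst.
  apply/cvgrPdist_lt => x x0; move/cvgrPdist_lt : sq0 => /(_ (x ^+ 2)).
  rewrite exprn_gt0// => /(_ isT); apply: filterS => n.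
  rewrite !sub0r !normrN normr_id normrX.
  by rewrite ltr_pXn2r ?nnegrE// ltW.
have zE c : L2tuple mu c -> dd z c = dd g c - dd v c by move=> lc;
  exact: L2dotBl.
(* [dd (u n) (conj (e k) w)] is constant in [n] from [k.+1] on. *)
have z_e k w : P k -> dd z (fun j t => conj (e' k j t) *: w) = 0.
  move=> Pk; have lc :
    L2tuple mu (fun j t => conj (e' k j t) *: w) by exact: L2tuple_conjZ.
  rewrite zE// L2dot_pod// (_ : pod_op _ _ _ = a k); last by rewrite /a /e' Pk.
  apply/eqP; rewrite subr_eq0; apply/eqP.
  rewrite -(cvg_lim (@Rhausdorff R) (ddv _ lc)); apply/esym/cvg_lim => //.
  apply: cvg_near_cst; exists k.+1 => // n /= kn.
  by apply/eqP; rewrite dd_uv.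
have z_v w : \forall t \ae mu, forall j, dotH V (z j t) w = 0.
  pose h : 'I_m -> T -> K := fun j t => dotH V w (z j t).
  have lh : @L2tuple R s _ _ mu m K^o h.
    by move=> j; apply: L2_ae (L2_conj (L2_dot w (lz j))); apply: nearW => t;
      rewrite -dotC.
  (* Up to conjugation, [c] times this inner product is the one of [z] with
     [conj (e k) (c w)]. *)
  have h_e k : P k -> dotS mu h (e k) = 0.
    move=> Pk; apply: scalar_ext => c; rewrite mulr0 re0 mulrC re_dotS//;
      last exact: l2e.
    rewrite -[RHS](z_e k (c *: w) Pk); apply: eq_Rintegral => t _.
    apply: eq_bigr => j _.
    rewrite /rdot dotZr conjK dotZr /h /e' Pk -[LHS]re_conj !conjM conjK.
    by rewrite -dotC; congr (re _); ring.
  have h0 := hker lh h_e.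
  have lhw : L2tuple mu (fun j t => conj (h j t) *: w) by exact: L2tuple_conjZ.
  (* Each [b l] is a multiple of [conj (e l)], to which [h] is orthogonal. *)
  have vh : dd v (fun j t => conj (h j t) *: w) = 0.
    rewrite -(cvg_lim (@Rhausdorff R) (ddv _ lhw)); apply/cvg_lim => //.
    rewrite (_ : (fun n => _) = fun=> 0); first exact: cvg_cst.
    apply/funext; elim=> [|n IH]; first by rewrite dd_u0.
    rewrite dd_uS// IH add0r /b L2dot_conj// /e' /a; case: ifPn => Pn.
      by rewrite h_e// mul0r re0.
    by rewrite dot0l mulr0 re0.
  have := zE _ lhw;
    rewrite vh (L2dot_pod w lg lh) h0 (ip0l hV) subr0 => /Rintegral_ae_eq0.
  move=> /(_ (L2dot_sum lz lhw).1).
  (* With this choice of [h] the integrand is a square. *)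
  have E j t :
    rdot (z j t) (conj (h j t) *: w) = rnorm (dotH V (z j t) w : K^o) ^+ 2.
    rewrite /rdot dotZr conjK /h dotC mulrC mul_conj.
    by rewrite [X in X ^+ 2]normE -ofRX re_ofR.
  have pos t j :
    0 <= rdot (z j t) (conj (h j t) *: w) by rewrite E rnorm_sqr_ge0.
  move=> /(_ (fun t => sumr_ge0 _ (fun j _ => pos t j))).
  apply: filterS => t /eqP; rewrite psumr_eq0// => /allP zt j.
  have := zt j; rewrite mem_index_enum => /(_ isT)/=.
  by rewrite E sqrf_eq0 => /eqP/(@rnorm_eq0 _ _ K^o).
have Ez : dd z z = 0 by exact: L2dot_eq0.
rewrite -L2dot_sqr//.
have luv n : L2tuple mu (fun j t => u n j t - v j t) by exact: L2tupleB.
have SE n : S n = dd g g -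
    dd (fun j t => u n j t - v j t) (fun j t => u n j t - v j t).
  have := dd_gBu n; have -> : (fun j t => g j t - u n j t) =
      (fun j t => z j t - (u n j t - v j t)).
    by apply/funext => j; apply/funext => t; rewrite /z opprB addrA subrK.
  have : dd z (fun j t => u n j t - v j t) = 0.
    apply/eqP; rewrite -sqrf_eq0 eq_le sqr_ge0 andbT.
    by apply: (le_trans (L2dot_cauchy_schwarz lz (luv n))); rewrite Ez mul0r.
  by rewrite L2dot_sqrB// Ez => ->; lra.
rewrite (_ : S = (fun n => dd g g -
    dd (fun j t => u n j t - v j t) (fun j t => u n j t - v j t)));
      last exact/funext.
by rewrite -[X in _ --> X](subr0 (dd g g)); apply: cvgB => //; exact: cvg_cst.
Qed.

End hilbert_schmidt.

(** * Bounded linear images of the data *)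

Section bounded_linear.
Context {R : realType} {s : scalar_kind}.
Local Notation K := (scalars R s).

Definition bounded_linear (U V : normedModType K) (M : U -> V) :=
  (forall (a : K) x y, M (a *: x + y) = a *: M x + M y) /\
  exists C, opnorm_le M C.

Section bounded_linear_theory.
Context {U V : normedModType K} (M : U -> V).
Hypothesis bM : bounded_linear M.

Lemma bounded_linearD x y : M (x + y) = M x + M y.
Proof. by have := bM.1 1 x y; rewrite !scale1r. Qed.

Lemma bounded_linear0 : M 0 = 0.
Proof.
by have := bounded_linearD 0 0; rewrite addr0 => /eqP;
  rewrite addrC -subr_eq subrr => /eqP.
Qed.

Lemma bounded_linearZ (a : K) x : M (a *: x) = a *: M x.
Proof. by have := bM.1 a x 0; rewrite bounded_linear0 !addr0. Qed.

Lemma bounded_linearB x y : M (x - y) = M x - M y.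
Proof. by rewrite -scaleN1r bounded_linearD bounded_linearZ scaleN1r. Qed.

Lemma bounded_linear_sum (J : Type) (r : seq J) (P : pred J) (x : J -> U) :
  M (\sum_(j <- r | P j) x j) = \sum_(j <- r | P j) M (x j).
Proof.
elim: r => [|j r IH]; first by rewrite !big_nil bounded_linear0.
by rewrite !big_cons; case: ifP => // _; rewrite bounded_linearD IH.
Qed.

Lemma bounded_linear_bound :
  exists2 C, 0 <= C & forall x, rnorm (M x) <= C * rnorm x.
Proof.
case: bM => _ [C MC]; exists `|C|; first exact: normr_ge0.
by move=> x; rewrite (le_trans (MC x))// ler_wpM2r ?rnorm_ge0 ?ler_norm.
Qed.

Lemma bounded_linear_cvg (u : nat -> U) x : u @ \oo --> x ->
  (fun n => M (u n)) @ \oo --> M x.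
Proof.
have [C C0 MC] := bounded_linear_bound.
move=> /cvg_rnorm ux; apply/cvg_rnorm.
apply: (@squeeze_cvgr _ _ _ _ (fun=> 0) (fun n => C * rnorm (u n - x))).
- by apply: nearW => n; rewrite rnorm_ge0/= -bounded_linearB MC.
- exact: cvg_cst.
- by rewrite -[X in _ --> X](mulr0 C); apply: cvgM => //; exact: cvg_cst.
Qed.

End bounded_linear_theory.

Lemma bounded_linear_add (U V : normedModType K) (M N : U -> V) :
  bounded_linear M -> bounded_linear N ->
  bounded_linear (fun x => M x + N x).
Proof.
move=> bM bN; split.
  by move=> a x y; rewrite bM.1 bN.1 scalerDr addrACA.
have [C _ MC] := bounded_linear_bound bM;
  have [D _ ND] := bounded_linear_bound bN.
exists (C + D) => x; rewrite (le_trans (rnormD _ _))// mulrDl lerD//.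
Qed.

Lemma bounded_linear_opp (U V : normedModType K) (M : U -> V) :
  bounded_linear M ->
  bounded_linear (fun x => - M x).
Proof.
move=> bM; split; first by move=> a x y; rewrite bM.1 opprD scalerN.
by have [C _ MC] := bounded_linear_bound bM; exists C => x; rewrite rnormN.
Qed.

Lemma bounded_linear_id (U : normedModType K) : bounded_linear (fun x : U => x).
Proof. by split => //; exists 1 => x; rewrite mul1r. Qed.

Lemma bounded_linear_cst0 (U V : normedModType K) :
  bounded_linear (fun _ : U => 0 : V).
Proof.
by split => [a x y|];
  [rewrite scaler0 addr0|exists 0 => x; rewrite rnorm0 mul0r].
Qed.

Lemma opnorm_le_bounded_linear (U V : normedModType K) (M : {linear U -> V}) C :
  opnorm_le M C -> bounded_linear M.
Proof. by move=> MC; split; [move=> a x y; rewrite linearP|exists C]. Qed.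

End bounded_linear.

Section pod_operators.
Context {R : realType} {s : scalar_kind} {d : measure_display}
  {T : measurableType d} (mu : {measure set T -> \bar R}) {m : nat}.
Local Notation K := (scalars R s).
Local Notation I h := (Rintegral mu setT h).

Lemma L2_bounded_linear (U V : normedModType K) (M : U -> V) (f : T -> U) :
  bounded_linear M ->
  L2 mu f -> L2 mu (fun t => M (f t)).
Proof.
move=> bM [sf iff]; have [C C0 MC] := bounded_linear_bound bM.
have sM : strongly_measurable mu (fun t => M (f t)).
  apply: (sm_op1 (op := M) _ _ sf); first exact: bounded_linear0.
  by move=> u x; exact: bounded_linear_cvg.
split => //;
  apply: (ae_integrable_dom (sm_rnorm 2 sM) (ae_integrableZ (C ^+ 2) iff)).
apply: nearW => t; rewrite ger0_norm ?rnorm_sqr_ge0// -exprMn.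
by rewrite lerXn2r ?nnegrE ?mulr_ge0 ?rnorm_ge0.
Qed.

(** Tested with a vector [y], the composition of [M] with the inner product by
    [y] is a bounded real-linear form, to which [bochner_form] applies. *)
Lemma pod_bounded_linear (U V : sep_hilbert R s) (M : U -> V)
    (g : 'I_m -> T -> U) (h : 'I_m -> T -> K) :
  bounded_linear M -> L2tuple mu g -> @L2tuple R s _ _ mu m K^o h ->
  pod_op mu (fun j t => M (g j t)) h = M (pod_op mu g h).
Proof.
move=> bM lg lh; rewrite /pod_op bounded_linear_sum//; apply: eq_bigr => j _.
have [C C0 MC] := bounded_linear_bound bM.
apply: (bochner_ext (rdot_ip V) (@complete_seq_complete R s V)).
  by apply: bochner_integrableZ => //; exact: L2_bounded_linear.
move=> y; rewrite (bochner_form (rdot_ip U) (@complete_seq_complete R s U)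
  (l := fun x => rdot (M x) y)).
- by apply: eq_Rintegral => t _; rewrite bounded_linearZ.
- split=> [x z|a x]; first by rewrite bounded_linearD// (ipDl (rdot_ip V)).
  by rewrite bounded_linearZ// (ipZl (rdot_ip V)).
- exists (C * rnorm y) => x;
    rewrite (le_trans (ip_cauchy_schwarz (rdot_ip V) _ _))//.
  by rewrite mulrAC ler_wpM2r ?rnorm_ge0.
- exact: bochner_integrableZ.
Qed.

Lemma pod_opD (V : sep_hilbert R s) (g g' : 'I_m -> T -> V)
    (h : 'I_m -> T -> K) : L2tuple mu g -> L2tuple mu g' ->
      @L2tuple R s _ _ mu m K^o h ->
  pod_op mu (fun j t => g j t + g' j t) h = pod_op mu g h + pod_op mu g' h.
Proof.
move=> lg lg' lh; rewrite /pod_op -big_split; apply: eq_bigr => j _ /=.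
apply: (bochner_ext (rdot_ip V) (@complete_seq_complete R s V)).
  by apply: bochner_integrableZ => //; exact: L2_D.
move=> y; have si := bochner_integrableZ (lh j) (lg j);
  have si' := bochner_integrableZ (lh j) (lg' j).
have iy := ip_form (rdot_ip V) y; have by_ := ip_bounded (rdot_ip V) y.
have bE (u : T -> V) : bochner_integrable mu u ->
  rdot (bochner mu u) y = I (fun t => rdot (u t) y).
  exact: (bochner_form (rdot_ip V) (@complete_seq_complete R s V) iy by_).
have iE (u : T -> V) : bochner_integrable mu u ->
  ae_integrable mu (fun t => rdot (u t) y).
  exact: (ae_integrable_form iy by_).
transitivity
  (I (fun t => rdot (h j t *: g j t) y) +
   I (fun t => rdot (h j t *: g' j t) y)).
  rewrite (ipDl (rdot_ip V)); congr (_ + _); [exact: bE|exact: bE].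
rewrite -(Rintegral_aeD (iE _ si) (iE _ si')).
by apply: eq_Rintegral => t _; rewrite scalerDr (ipDl (rdot_ip V)).
Qed.

End pod_operators.

Section residual.
Context {R : realType} {s : scalar_kind} {d : measure_display}
  {T : measurableType d} (mu : {measure set T -> \bar R})
  {X Y V : sep_hilbert R s} (L : linop X Y) {m : nat} (w : 'I_m -> T -> X).
Local Notation K := (scalars R s).
Hypotheses (hw : forall j, inL2 mu (w j))
  (hLw : pod_standing_assumption mu L w).
Variables (sigma : nat -> R) (f : nat -> 'I_m -> T -> K) (phi : nat -> X).
Hypothesis hsvd : is_svd mu w sigma f phi.

Lemma linop0 : L 0 = 0.
Proof.
have := linop_linear (1 : K) (dom0 L) (dom0 L).
by rewrite !scale1r addr0 => /eqP; rewrite addrC -subr_eq subrr => /eqP.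
Qed.

Lemma linop_domZ (a : K) x : dom L x -> dom L (a *: x).
Proof.
by move=> dx; rewrite -[_ *: _]addr0; apply: dom_linear => //; exact: dom0.
Qed.

Lemma linopZ (a : K) x : dom L x -> L (a *: x) = a *: L x.
Proof.
move=> dx; have := linop_linear a dx (dom0 L); rewrite addr0 => ->.
by rewrite linop0 addr0.
Qed.

Lemma sigma_ge0 k : (0 < k)%N -> 0 <= sigma k.
Proof. by case: hsvd => + _ _ _ k0 => /(_ k k0) /andP[]; exact: le_trans. Qed.

Lemma sigma_le k l : (0 < k)%N -> (k <= l)%N -> sigma l <= sigma k.
Proof.
move=> k0; elim: l => [|l IH]; first by rewrite leqn0 => /eqP ->.
rewrite leq_eqVlt => /predU1P[->//|kl].
apply: le_trans (IH kl); case: hsvd => + _ _ _.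
by move=> /(_ l (leq_trans k0 kl))/andP[].
Qed.

Lemma phi_dom k : (0 < k)%N -> 0 < sigma k -> dom L (phi k).
Proof.
move=> k0 sk; case: hsvd => _ /(_ k k0 sk)[Sf Kf _] _ _.
case: hLw => _ _ /(_ _ Sf)[+ _];
  rewrite Kf => /(linop_domZ (of_real s (sigma k)^-1)).
by rewrite scalerA -ofRM mulVf ?gt_eqF// ofR1 scale1r.
Qed.

Lemma inSP h : inS mu h <-> @L2tuple R s _ _ mu m K^o h.
Proof. by split=> hh j; apply/inL2P; exact: hh. Qed.

Variables (M : Y -> V) (N : X -> V).
Hypotheses (bM : bounded_linear M) (bN : bounded_linear N).
Let g j t := M (L (w j t)) + N (w j t).

Let lw : L2tuple mu w. Proof. by move=> j; exact/inL2P. Qed.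
Let lLw : L2tuple mu (fun j t => L (w j t)).
Proof. by case: hLw => _ h _ j; exact/inL2P. Qed.

Lemma residual_L2 : L2tuple mu g.
Proof. by move=> j; apply: L2_D; exact: L2_bounded_linear. Qed.

(** The map [L] need not be bounded; the standing assumption makes it commute
    with the integrals that define [K]. *)
Lemma residual_pod h : inS mu h ->
  pod_op mu g h = M (L (pod_op mu w h)) + N (pod_op mu w h).
Proof.
move=> Sh; have lh := (inSP h).1 Sh.
rewrite pod_opD ?(pod_bounded_linear bM) ?(pod_bounded_linear bN)//;
  try by move=> j; exact: L2_bounded_linear.
by case: hLw => _ _ /(_ _ Sh)[_ ->].
Qed.

(** The Hilbert-Schmidt identity for [g = M L w + N w], with the singular
    functions [f_k] of index [k >= 1] and [sigma_k > 0]: an [h] orthogonal to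
    all of them has [K h = 0] by the singular value expansion, so
    [M L K h + N K h = 0]. *)
Lemma residual_cvg :
  \sum_(1 <= k < n) sigma k ^+ 2 * rnorm (M (L (phi k)) + N (phi k)) ^+ 2
    @[n --> \oo] --> \sum_(j < m) L2sq mu (g j).
Proof.
pose P k := (0 < k)%N && (0 < sigma k).
have [_ hf horth hexp] := hsvd.
have := pod_sum_sqr_cvg (g := g) (e := f) (P := P) residual_L2 _ _ _.
rewrite (_ : (fun n => \sum_(k < n) _) = (fun n => \sum_(1 <= k < n)
    sigma k ^+ 2 * rnorm (M (L (phi k)) + N (phi k)) ^+ 2)); last first.
  apply/funext => n.
  pose c k := rnorm (if P k then pod_op mu g (f k) else 0) ^+ 2.
  rewrite -(big_mkord xpredT c); case: n => [|n]; first by rewrite !big_geq.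
  rewrite big_ltn// {1}/c /P ltnn rnorm0 expr0n add0r.
  rewrite !big_nat; apply: eq_bigr => k /andP[k0 _]; rewrite /c /P k0/=.
  case: ifPn => [sk|]; last first.
    rewrite lt_neqAle sigma_ge0// andbT negbK => /eqP <-.
    by rewrite rnorm0 expr0n mul0r.
  have [Sf Kf _] := hf k k0 sk; have dphi := phi_dom k0 sk.
  rewrite residual_pod// Kf linopZ// (bounded_linearZ bM) (bounded_linearZ bN)
    -scalerDr rnormZR.
  by rewrite exprMn real_normK ?num_real.
apply.
- by move=> k /andP[k0 sk]; apply/inSP; case: (hf k k0 sk).
- by move=> k l /andP[k0 sk] /andP[l0 sl]; case: (horth k l k0 l0 sk sl).
- move=> h lh hk; have Sh := (inSP h).2 lh.
  have K0 : pod_op mu w h = 0.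
    have := hexp _ Sh; rewrite (_ : (fun n => _) = fun=> 0).
      by move=> /(cvg_lim (@norm_hausdorff _ X)); rewrite lim_cst//;
        exact: norm_hausdorff.
    apply/funext => n; rewrite big_nat big1// => k /andP[k0 _].
    have [sk|] := ltP 0 (sigma k); first by rewrite hk ?mulr0 ?scale0r// /P k0.
    move=> sk; have -> : sigma k = 0 by apply/eqP; rewrite eq_le sk sigma_ge0.
    by rewrite ofR0 mul0r scale0r.
  by rewrite residual_pod// K0 linop0 (bounded_linear0 bM) (bounded_linear0 bN)
    addr0.
Qed.

Lemma residual_sum_sqr :
  sum_sqr_L2norm mu g = (\sum_(j < m) L2sq mu (g j))%:E.
Proof.
rewrite /sum_sqr_L2norm -sumEFin; apply: eq_bigr => j _.
by apply: L2norm_sqr; exact: residual_L2.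
Qed.

End residual.

(** * Tails of series *)

Section tails.
Context {R : realType}.
Implicit Types c : nat -> R.

Lemma eq_eseries_from (a b : nat -> \bar R) r :
  (forall k, (r < k)%N -> a k = b k) ->
  (\sum_(r.+1 <= k <oo) a k = \sum_(r.+1 <= k <oo) b k)%E.
Proof.
move=> ab; congr (limn _); apply/funext => n.
by apply: eq_big_nat => k /andP[rk _]; exact: ab.
Qed.

Lemma eseries_tail c (E : R) r :
  \sum_(1 <= k < n) c k @[n --> \oo] --> E ->
  (\sum_(r.+1 <= k <oo) (c k)%:E = (E - \sum_(1 <= k < r.+1) c k)%:E)%E.
Proof.
move=> cE; apply/cvg_lim => //.
have : (fun n => \sum_(1 <= k < n) c k - \sum_(1 <= k < r.+1) c k) @ \oo -->
    E - \sum_(1 <= k < r.+1) c k.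
  by apply: cvgB => //; exact: cvg_cst.
move=> h; apply: cvg_EFin; first by apply: nearW => n; rewrite sumEFin.
apply: cvg_trans h; apply: near_eq_cvg; exists r.+1 => // n /= rn.
by rewrite sumEFin/= [X in X - _](big_cat_nat _ rn)//= addrAC subrr add0r.
Qed.

(** The errors are squeezed between 0 and the tails of one convergent series.
    *)
Lemma eseries_tail_cvg0 c (E : R) (err : nat -> \bar R) (c' : nat -> nat -> R) :
  \sum_(1 <= k < n) c k @[n --> \oo] --> E ->
  (forall r, (0 < r)%N -> err r = \sum_(r.+1 <= k <oo) (c' r k)%:E)%E ->
  (forall r k, (0 < r)%N -> (r < k)%N -> 0 <= c' r k <= c k) ->
  (err r @[r --> \oo] --> 0)%E.
Proof.
move=> cE errE cc.
apply: (@squeeze_cvge _ _ _ _ (fun=> 0%E) _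
  (fun r => (E - \sum_(1 <= k < r.+1) c k)%:E)).
- exists 1%N => // r /= r0; rewrite errE// -(eseries_tail r cE).
  apply/andP; split.
    by apply: nneseries_ge0 => k rk _; rewrite lee_fin;
      case/andP: (cc r k r0 rk).
  apply: lee_lim.
  - apply: is_cvg_ereal_nneg_natsum_cond => k rk _.
    by rewrite lee_fin; case/andP: (cc r k r0 rk).
  - apply: is_cvg_ereal_nneg_natsum_cond => k rk _.
    by rewrite lee_fin; case/andP: (cc r k r0 rk); exact: le_trans.
  - apply: nearW => n; rewrite big_nat [leRHS]big_nat.
    apply: lee_sum => k /andP[rk _].
    by rewrite lee_fin; case/andP: (cc r k r0 rk).
- exact: cvg_cst.
- apply: cvg_EFin; first exact: nearW.
  rewrite -[X in _ --> X](subrr E); apply: cvgB; first exact: cvg_cst.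
  by rewrite -(cvg_shiftS (fun n => \sum_(1 <= k < n) c k)) in cE.
Qed.

End tails.

(** * Finite-dimensional subspaces *)

Section finite_span.
Context {R : realType} {s : scalar_kind}.
Local Notation K := (scalars R s).

Lemma span_uptoS (X : lmodType K) (v : nat -> X) r x :
  span_upto v r.+1 x <->
  exists y (c : K), span_upto v r y /\ x = y + c *: v r.+1.
Proof.
split=> [[c ->]|[_ [a [[c ->] ->]]]].
  exists (\sum_(1 <= k < r.+1) c k *: v k), (c r.+1); split; first by exists c.
  by rewrite big_nat_recr.
(* The coefficients [c k] with [k > r] are arbitrary, so [a] may replace one.
   *)
exists (fun k => if k == r.+1 then a else c k).
rewrite [RHS]big_nat_recr//= eqxx; congr (_ + _).
by apply: eq_big_nat => k /andP[_ kr]; rewrite lt_eqF.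
Qed.

Lemma span_upto_lin (X : lmodType K) (v : nat -> X) r (a : K) x y :
  span_upto v r x -> span_upto v r y -> span_upto v r (a *: x + y).
Proof.
move=> [c ->] [c' ->]; exists (fun k => a * c k + c' k).
rewrite scaler_sumr -big_split; apply: eq_bigr => k _ /=.
by rewrite scalerDl scalerA.
Qed.

Lemma span_upto0 (X : lmodType K) (v : nat -> X) r : span_upto v r 0.
Proof. by exists (fun=> 0); rewrite big1// => k _; rewrite scale0r. Qed.

Section hilbert.
Variable Y : sep_hilbert R s.
Implicit Types (x y v : Y).

Lemma dot0r x : dotH Y x 0 = 0.
Proof. by rewrite dotC dot0l conj0. Qed.

Lemma dot_suml (J : Type) (r : seq J) (P : pred J) (u : J -> Y) y :
  dotH Y (\sum_(j <- r | P j) u j) y = \sum_(j <- r | P j) dotH Y (u j) y.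
Proof.
elim: r => [|j r IH]; first by rewrite !big_nil dot0l.
by rewrite !big_cons; case: ifP => // _; rewrite dotDl IH.
Qed.

Lemma dot_sumr (J : Type) (r : seq J) (P : pred J) (u : J -> Y) y :
  dotH Y y (\sum_(j <- r | P j) u j) = \sum_(j <- r | P j) dotH Y y (u j).
Proof.
elim: r => [|j r IH]; first by rewrite !big_nil dot0r.
by rewrite !big_cons; case: ifP => // _; rewrite dotDr IH.
Qed.

Lemma dot_eq0 x : dotH Y x x = 0 -> x = 0.
Proof. by rewrite dotE => /eqP; rewrite sqrf_eq0 normr_eq0 => /eqP. Qed.

Definition expand (es : seq Y) x := \sum_(e <- es) dotH Y x e *: e.

Lemma expand_adjoint es x y :
  dotH Y (expand es x) y = dotH Y x (expand es y).
Proof.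
rewrite dot_suml dot_sumr; apply: eq_bigr => e _.
by rewrite dotZl dotZr -dotC mulrC.
Qed.

Lemma expand_lin es (a : K) x y :
  expand es (a *: x + y) = a *: expand es x + expand es y.
Proof.
rewrite /expand scaler_sumr -big_split; apply: eq_bigr => e _ /=.
by rewrite dotDl dotZl scalerDl scalerA.
Qed.

(** A family that reproduces the span makes [expand es] a self-adjoint
    projection onto it. This alone shows that the difference between the next
    vector and its expansion is orthogonal to the span, so orthonormality of
    [es] is not part of the induction. *)
Lemma gram_schmidt (v : nat -> Y) r : exists es : seq Y,
  {in es, forall e, span_upto v r e} /\
  forall x, span_upto v r x -> expand es x = x.
Proof.
elim: r => [|r [es [esv esE]]].
  exists [::]; split => // x [c ->].
  by rewrite big_geq// /expand big_nil.
have expv x : span_upto v r (expand es x).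
  rewrite /expand; elim: es esv {esE} => [|e es IH] esv.
    by rewrite big_nil; exact: span_upto0.
  rewrite big_cons; apply: span_upto_lin; first by apply: esv; rewrite mem_head.
  by apply: IH => e' e'es; apply: esv; rewrite in_cons e'es orbT.
have upS x : span_upto v r x -> span_upto v r.+1 x.
  by move=> vx; apply/span_uptoS; exists x, 0; rewrite scale0r addr0.
set u := v r.+1; pose u' := u - expand es u.
have uE : u = expand es u + u' by rewrite addrC subrK.
have ort x : span_upto v r x -> dotH Y u' x = 0.
  by move=> vx; rewrite dotBl expand_adjoint esE// subrr.
have expu' : expand es u' = 0.
  rewrite /expand big_seq big1// => e /esv/ort ->; by rewrite scale0r.
have decomp x : span_upto v r.+1 x ->
  exists y c, span_upto v r y /\ x = c *: u' + y.
  move=> /span_uptoS[y [c [vy ->]]]; exists (c *: expand es u + y), c; split.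
    exact: span_upto_lin.
  by rewrite -/u [in LHS]uE scalerDr addrC [RHS]addrCA addrA.
have [u'0|u'0] := eqVneq u' 0.
  exists es; split => [e /esv/upS//|x /decomp[y [c [vy ->]]]].
  by rewrite u'0 scaler0 add0r esE.
pose n := rnorm u'; have n0 : n != 0.
  by apply: contra u'0 => /eqP/rnorm_eq0/eqP.
pose e := of_real s n^-1 *: u'.
have ve : span_upto v r.+1 e.
  rewrite /e -[_ *: _]addr0; apply: span_upto_lin; last exact: span_upto0.
  apply/span_uptoS; exists (- expand es u), 1; split;
    last by rewrite scale1r addrC.
  by rewrite -[- _]addr0 -scaleN1r; apply: span_upto_lin => //;
    exact: span_upto0.
exists (e :: es); split.
  by move=> e'; rewrite in_cons => /predU1P[->//|/esv/upS].
move=> x /decomp[y [c [vy ->]]].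
rewrite /expand big_cons -/(expand es _) expand_lin expu' scaler0 add0r esE//.
congr (_ + _); rewrite /e dotDl dotZr conj_ofR dotZl.
rewrite (dotC y) dotZl (ort _ vy) mulr0 conj0 addr0.
rewrite dotE normE -ofRX scalerA; congr (_ *: _).
rewrite -[RHS]mulr1 -(ofR1 (R := R) (s := s)) -(_ : n^-1 * n ^+ 2 * n^-1 = 1).
  by rewrite !ofRM; ring.
by rewrite expr2 mulrA mulVf// mul1r divff.
Qed.

End hilbert.

(** On the span, [B x] is the sum of the [(x, e) B e] for [e] in a Gram-Schmidt
    family. *)
Lemma finite_dim_bounded (V : normedModType K) (Y : sep_hilbert R s)
    (v : nat -> Y) r (B : Y -> V) :
  (forall (a : K) x y, span_upto v r x -> span_upto v r y ->
     B (a *: x + y) = a *: B x + B y) ->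
  exists2 C, 0 <= C & forall x, span_upto v r x -> rnorm (B x) <= C * rnorm x.
Proof.
move=> Blin; have [es [esv esE]] := gram_schmidt v r.
have B0 : B 0 = 0.
  have := Blin 1 0 0 (span_upto0 v r) (span_upto0 v r).
  by rewrite !scale1r addr0 => /eqP; rewrite addrC -subr_eq subrr => /eqP.
suff [C C0 BC] : exists2 C, 0 <= C & forall x,
    span_upto v r (expand es x) /\ rnorm (B (expand es x)) <= C * rnorm x.
  by exists C => // x /esE {1}<-; exact: (BC x).2.
elim: es esv {esE} => [_|e es IH esv].
  exists 0 => // x; rewrite /expand big_nil B0 rnorm0 mul0r.
  by split => //; exact: span_upto0.
have [|C C0 BC] := IH.
  by move=> e' e'es; apply: esv; rewrite in_cons e'es orbT.
have ve : span_upto v r e by apply: esv; rewrite mem_head.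
exists (rnorm e * rnorm (B e) + C);
  first by rewrite addr_ge0 ?mulr_ge0 ?rnorm_ge0.
move=> x; have [vx Bx] := BC x.
rewrite /expand big_cons -/(expand es x); split; first exact: span_upto_lin.
rewrite Blin// (le_trans (rnormD _ _))// mulrDl lerD// rnormZ.
rewrite -/(rnorm (dotH Y x e : K^o)) mulrAC ler_wpM2r ?rnorm_ge0//.
by rewrite mulrC dot_cauchy_schwarz.
Qed.

End finite_span.

(** * The projection onto X_r and the inverse of L on its image *)

Section operator_facts.
Context {R : realType} {s : scalar_kind} {X Y : sep_hilbert R s}
  (L : linop X Y).
Local Notation K := (scalars R s).
Variables (phi : nat -> X) (r : nat).

Hypothesis dphi : forall k, (0 < k <= r)%N -> dom L (phi k).

Lemma span_dom_sum (c : nat -> K) :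
  dom L (\sum_(1 <= k < r.+1) c k *: phi k) /\
  L (\sum_(1 <= k < r.+1) c k *: phi k) = \sum_(1 <= k < r.+1) c k *: L (phi k).
Proof.
elim: r dphi => [|n IH] dphi'.
  by rewrite !big_geq//; split; [exact: dom0|exact: linop0].
have [|dn Ln] := IH.
  by move=> k /andP[k0 kn]; apply: dphi'; rewrite k0 leqW.
have dp : dom L (phi n.+1) by apply: dphi'; rewrite leqnn.
rewrite !(big_nat_recr n.+1)//= -!(addrC (c n.+1 *: _)).
by split; [exact: dom_linear|rewrite linop_linear// Ln].
Qed.

Lemma span_dom x : span_upto phi r x -> dom L x.
Proof. by move=> [c ->]; case: (span_dom_sum c). Qed.

Lemma span_image y :
  (L @` span_upto phi r) y <-> span_upto (fun k => L (phi k)) r y.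
Proof.
split=> [[_ [c ->] <-]|[c ->]].
  by exists c; rewrite (span_dom_sum c).2.
by exists (\sum_(1 <= k < r.+1) c k *: phi k);
  [exists c|rewrite (span_dom_sum c).2].
Qed.

Lemma linop_invK x : invertible L -> dom L x -> linop_inv L (L x) = x.
Proof.
move=> iL dx; rewrite /linop_inv.
have [d' e] := @xgetPex _ 0 [set x' | dom L x' /\ L x' = L x]
  (ex_intro _ x (conj dx erefl)).
exact: iL.
Qed.

(** [L^-1] may be unbounded, but here it only acts on the finite-dimensional
    range of [P]. *)
Lemma inv_proj_bounded (P : {linear Y -> Y}) : invertible L ->
  is_bounded_proj P (L @` span_upto phi r) ->
    bounded_linear (fun y => linop_inv L (P y)).
Proof.
move=> iL [[C PC] rP _].
have PS y : (L @` span_upto phi r) (P y) by rewrite -rP; exists y.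
have lin (a : K) y z : (L @` span_upto phi r) y -> (L @` span_upto phi r) z ->
    linop_inv L (a *: y + z) = a *: linop_inv L y + linop_inv L z.
  move=> [x sx <-] [x' sx' <-]; have dx := span_dom sx;
    have dx' := span_dom sx'.
  rewrite -linop_linear// !linop_invK//; exact: dom_linear.
have [|D D0 BD] := @finite_dim_bounded R s X Y (fun k => L (phi k)) r
  (linop_inv L).
  by move=> a y z /span_image sy /span_image sz; exact: lin.
split; first by move=> a y z; rewrite linearP lin.
exists (D * C) => y; have /span_image sy := PS y.
by rewrite (le_trans (BD _ sy))// -mulrA ler_wpM2l// PC.
Qed.

Hypothesis ortho : forall k l, (0 < k <= r)%N -> (0 < l <= r)%N ->
  dotH X (phi k) (phi l) = (k == l)%:R.

(** The Fourier sum satisfies the conditions that characterize the projection,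
    and two solutions differ by a vector of the span orthogonal to the span. *)
Lemma orth_projE x :
  orth_proj (span_upto phi r) x = \sum_(1 <= k < r.+1) dotH X x (phi k)
    *: phi k.
Proof.
set p := \sum_(1 <= k < r.+1) _.
have pS : span_upto phi r p by exists (fun k => dotH X x (phi k)).
have pl l : (0 < l <= r)%N -> dotH X p (phi l) = dotH X x (phi l).
  move=> /andP[l0 lr]; rewrite /p dot_suml (bigD1_seq l) ?iota_uniq//=;
    last first.
    by rewrite mem_index_iota l0.
  rewrite dotZl ortho ?l0// eqxx mulr1 big1_seq ?addr0// => k /andP[kl].
  rewrite mem_index_iota => /andP[k0 kr]; rewrite dotZl ortho ?l0// ?k0//.
  by rewrite (negbTE kl) mulr0.
have pP : [set p | span_upto phi r p /\
    forall v, span_upto phi r v -> dotH X (x - p) v = 0] p.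
  split => // _ [c ->]; rewrite dot_sumr big_nat big1// => l /andP[l0 lr].
  by rewrite dotZr dotBl pl ?l0// subrr mulr0.
have [qS qO] := @xgetPex _ 0 _ (ex_intro _ p pP).
rewrite /orth_proj; move: qS qO; set q := xget _ _ => qS qO.
apply/eqP; rewrite -subr_eq0; apply/eqP/dot_eq0.
have dS : span_upto phi r (q - p).
  by rewrite -scaleN1r addrC; exact: span_upto_lin.
have E : q - p = (x - p) - (x - q) by rewrite opprB [RHS]addrC subrKA.
by rewrite {1}E dotBl pP.2// qO// subrr.
Qed.

Lemma L_orth_proj_bounded :
  bounded_linear (fun x => L (orth_proj (span_upto phi r) x)).
Proof.
have E x : L (orth_proj (span_upto phi r) x) =
    \sum_(1 <= k < r.+1) dotH X x (phi k) *: L (phi k).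
  by rewrite orth_projE (span_dom_sum (fun k => dotH X x (phi k))).2.
split.
  move=> a x y; rewrite !E scaler_sumr -big_split; apply: eq_bigr => k _ /=.
  by rewrite dotDl dotZl scalerDl scalerA.
exists (\sum_(1 <= k < r.+1) rnorm (phi k) * rnorm (L (phi k))) => x.
rewrite E mulr_suml.
elim: (index_iota _ _) => [|k I IH]; first by rewrite !big_nil rnorm0.
rewrite !big_cons (le_trans (rnormD _ _))// lerD// rnormZ.
rewrite -/(rnorm (dotH X x (phi k) : K^o)) mulrAC ler_wpM2r ?rnorm_ge0//.
by rewrite mulrC dot_cauchy_schwarz.
Qed.

End operator_facts.

(** * The three projection errors *)

Section pod_errors.
Context {R : realType} {s : scalar_kind} {d : measure_display}
  {T : measurableType d} (mu : {measure set T -> \bar R})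
  {X Y : sep_hilbert R s} (L : linop X Y) {m : nat} (w : 'I_m -> T -> X).
Local Notation K := (scalars R s).
Hypotheses (hw : forall j, inL2 mu (w j))
  (hLw : pod_standing_assumption mu L w).
Variables (sigma : nat -> R) (f : nat -> 'I_m -> T -> K) (phi : nat -> X).
Hypothesis hsvd : is_svd mu w sigma f phi.
Variable PiY : nat -> {linear Y -> Y}.
Hypothesis hPiY : forall r, (0 < r)%N -> 0 < sigma r ->
  is_bounded_proj (PiY r) (L @` span_upto phi r).

(** The residual annihilates [X_r], so the sum given by [residual_cvg] reduces
    to its tail beyond [r]. *)
Lemma residual_tail (V : sep_hilbert R s) (M : Y -> V) (N : X -> V)
    (g : 'I_m -> T -> V) r (c : nat -> R) :
  bounded_linear M -> bounded_linear N ->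
  (forall j t, g j t = M (L (w j t)) + N (w j t)) ->
  (forall k, (0 < k <= r)%N -> M (L (phi k)) + N (phi k) = 0) ->
  (forall k, (r < k)%N -> 0 < sigma k ->
    rnorm (M (L (phi k)) + N (phi k)) = c k) ->
  (forall j, inL2 mu (g j)) /\
  sum_sqr_L2norm mu g =
    (\sum_(r.+1 <= k <oo) (sigma k ^+ 2 * c k ^+ 2)%:E)%E.
Proof.
move=> bM bN gE low high.
have {}gE : g = fun j t => M (L (w j t)) + N (w j t).
  by apply/funext => j; apply/funext => t.
rewrite gE; split.
  by move=> j; apply/inL2P; exact: (residual_L2 hw hLw bM bN).
rewrite (residual_sum_sqr hw hLw bM bN).
have cvgE := residual_cvg hw hLw hsvd bM bN.
rewrite (eq_eseries_from (b := fun k =>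
    (sigma k ^+ 2 * rnorm (M (L (phi k)) + N (phi k)) ^+ 2)%:E)); last first.
  move=> k rk; congr EFin; have [sk|sk] := ltP 0 (sigma k);
    first by rewrite high.
  suff -> : sigma k = 0 by rewrite expr0n !mul0r.
  apply/eqP; rewrite eq_le sk (sigma_ge0 hsvd)//; exact: leq_ltn_trans rk.
rewrite (eseries_tail r cvgE) [X in _ - X]big_nat [X in _ - X]big1 ?subr0//.
by move=> k /low ->; rewrite rnorm0 expr0n mulr0.
Qed.

Section fixed_rank.
Variables (r : nat) (r0 : (0 < r)%N) (sr : 0 < sigma r).

Lemma sigma_gt0 k : (0 < k <= r)%N -> 0 < sigma k.
Proof. by move=> /andP[k0 kr]; exact: lt_le_trans sr (sigma_le hsvd k0 kr). Qed.

Lemma phi_dom_le k : (0 < k <= r)%N -> dom L (phi k).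
Proof.
move=> kr; apply: (phi_dom hLw hsvd); [by case/andP: kr|exact: sigma_gt0].
Qed.

Lemma phi_orth k l : (0 < k)%N -> (0 < l)%N -> 0 < sigma k -> 0 < sigma l ->
  dotH X (phi k) (phi l) = (k == l)%:R.
Proof. by move=> k0 l0 sk sl; case: hsvd => _ _ /(_ k l k0 l0 sk sl)[]. Qed.

Lemma phi_orth_le k l : (0 < k <= r)%N -> (0 < l <= r)%N ->
  dotH X (phi k) (phi l) = (k == l)%:R.
Proof.
by move=> kr lr; apply: phi_orth; rewrite ?sigma_gt0//;
  [case/andP: kr|case/andP: lr].
Qed.

Lemma phi_image k : (0 < k <= r)%N -> (L @` span_upto phi r) (L (phi k)).
Proof.
move=> /andP[k0 kr]; exists (phi k) => //.
exists (fun l => (l == k)%:R).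
rewrite (bigD1_seq k) ?iota_uniq ?mem_index_iota ?k0//= eqxx scale1r.
by rewrite big1 ?addr0// => l /negbTE ->; rewrite scale0r.
Qed.

Lemma PiY_id k : (0 < k <= r)%N -> PiY r (L (phi k)) = L (phi k).
Proof.
move=> kr; have [_ rP PP] := hPiY r0 sr.
by have := phi_image kr; rewrite -rP => -[y _ <-]; exact: PP.
Qed.

Lemma PiY_bounded : bounded_linear (PiY r).
Proof.
by have [[C PC] _ _] := hPiY r0 sr; exact: opnorm_le_bounded_linear PC.
Qed.

Lemma errorA :
  (forall j, inL2 mu (residualA L w phi r j)) /\
  sum_sqr_L2norm mu (residualA L w phi r) =
    (\sum_(r.+1 <= k <oo) (sigma k ^+ 2 * rnorm (L (phi k)) ^+ 2)%:E)%E.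
Proof.
have projE := orth_projE phi_orth_le.
apply: (residual_tail (bounded_linear_id Y)
  (bounded_linear_opp (L_orth_proj_bounded phi_dom_le phi_orth_le))) => //.
  move=> k kr; rewrite projE.
  rewrite (bigD1_seq k)
    ?iota_uniq ?mem_index_iota//= phi_orth_le// eqxx scale1r.
  rewrite big1_seq ?addr0 ?subrr// => l /andP[lk].
  by rewrite mem_index_iota ltnS => lr;
    rewrite phi_orth_le// eq_sym (negbTE lk) scale0r.
move=> k rk sk; rewrite projE big_nat big1 ?linop0 ?subr0// => l /andP[l0 lr].
rewrite phi_orth ?(sigma_gt0 (k := l)) ?l0// ?(leq_ltn_trans _ rk)//.
by rewrite gtn_eqF ?scale0r// (leq_ltn_trans _ rk).
Qed.

Lemma errorB :
  (forall j, inL2 mu (residualB L w PiY r j)) /\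
  sum_sqr_L2norm mu (residualB L w PiY r) =
    (\sum_(r.+1 <= k <oo)
      (sigma k ^+ 2 * rnorm (L (phi k) - PiY r (L (phi k))) ^+ 2)%:E)%E.
Proof.
apply: (residual_tail
  (bounded_linear_add (bounded_linear_id Y) (bounded_linear_opp PiY_bounded))
  (bounded_linear_cst0 X Y)).
- by move=> j t; rewrite addr0.
- by move=> k kr; rewrite PiY_id// subrr addr0.
- by move=> k _ _; rewrite addr0.
Qed.

(** By [inv_proj_bounded] the map [L^-1 PiY_r] is bounded on [Y], hence
    commutes with the integrals of the [L w_j]. *)
Lemma errorC : invertible L ->
  (forall j, inL2 mu (residualC L w PiY r j)) /\
  sum_sqr_L2norm mu (residualC L w PiY r) =
    (\sum_(r.+1 <= k <oo)
      (sigma k ^+ 2 *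
       rnorm (phi k - linop_inv L (PiY r (L (phi k)))) ^+ 2)%:E)%E.
Proof.
move=> iL; have bB := inv_proj_bounded phi_dom_le iL (hPiY r0 sr).
apply: (residual_tail (bounded_linear_opp bB) (bounded_linear_id X)).
- by move=> j t; rewrite addrC.
- by move=> k kr; rewrite PiY_id// linop_invK ?addNr//; exact: phi_dom_le.
- by move=> k _ _; rewrite addrC.
Qed.

End fixed_rank.

Section infinite_rank.
Hypothesis infinite_rank : ~ finite_rank mu w.

(** If some [sigma_k] vanished, so would all later ones, and the singular value
    expansion would confine the range of [K] to the span of the first [k]
    singular vectors. *)
Lemma infinite_rank_sigma k : (0 < k)%N -> 0 < sigma k.
Proof.
move=> k0; rewrite ltNge; apply/negP => sk; apply: infinite_rank.
have s0 l : (k <= l)%N -> sigma l = 0.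
  move=> kl; apply/eqP; rewrite eq_le (sigma_ge0 hsvd) ?(leq_trans k0)// andbT.
  exact: le_trans (sigma_le hsvd k0 kl) sk.
exists k, phi => g Sg; exists (fun l => of_real s (sigma l) * dotS mu g (f l)).
case: hsvd => _ _ _ /(_ _ Sg) /(cvg_lim (@norm_hausdorff _ X)) <-.
apply/cvg_lim; first exact: norm_hausdorff.
apply: cvg_near_cst; exists k => // n /= kn.
rewrite (@big_cat_nat _ _ _ k.+1)//= -[RHS]addr0; congr (_ + _).
rewrite big_nat big1// => l /andP[kl _].
by rewrite (s0 _ (ltnW kl)) ofR0 mul0r scale0r.
Qed.

Let sum_Lphi : \sum_(1 <= k < n) sigma k ^+ 2 * rnorm (L (phi k)) ^+ 2
    @[n --> \oo] --> \sum_(j < m) L2sq mu (fun t => L (w j t) + 0).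
Proof.
have := residual_cvg hw hLw hsvd (bounded_linear_id Y)
  (bounded_linear_cst0 X Y).
apply: cvg_trans; apply: near_eq_cvg; apply: nearW => n.
by apply: eq_bigr => k _; rewrite addr0.
Qed.

Let sum_phi : \sum_(1 <= k < n) sigma k ^+ 2 * rnorm (phi k) ^+ 2
    @[n --> \oo] --> \sum_(j < m) L2sq mu (fun t => 0 + w j t).
Proof.
have := residual_cvg hw hLw hsvd (bounded_linear_cst0 Y X)
  (bounded_linear_id X).
apply: cvg_trans; apply: near_eq_cvg; apply: nearW => n.
by apply: eq_bigr => k _; rewrite add0r.
Qed.

Lemma weighted_tail_cvg0 (x : nat -> nat -> R) (y : nat -> R) (C E : R)
    (err : nat -> \bar R) :
  \sum_(1 <= k < n) sigma k ^+ 2 * y k ^+ 2 @[n --> \oo] --> E ->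
  (forall r, (0 < r)%N ->
    err r = \sum_(r.+1 <= k <oo) (sigma k ^+ 2 * x r k ^+ 2)%:E)%E ->
  (forall r k, (0 < r)%N -> (r < k)%N -> 0 <= x r k <= C * y k) ->
  (err r @[r --> \oo] --> 0)%E.
Proof.
move=> yE errE xy.
apply: (@eseries_tail_cvg0 R (fun k => C ^+ 2 * (sigma k ^+ 2 * y k ^+ 2))
  (C ^+ 2 * E) err (fun r k => sigma k ^+ 2 * x r k ^+ 2)) => //.
  under eq_fun do rewrite -mulr_sumr.
  by apply: cvgM => //; exact: cvg_cst.
move=> r k r0 rk; have /andP[x0 xCy] := xy r k r0 rk.
rewrite mulr_ge0 ?sqr_ge0//= [leRHS]mulrCA ler_wpM2l ?sqr_ge0// -exprMn.
by rewrite lerXn2r ?nnegrE// (le_trans x0).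
Qed.

Lemma errorA_cvg0 :
  (sum_sqr_L2norm mu (residualA L w phi r) @[r --> \oo] --> 0)%E.
Proof.
apply: (weighted_tail_cvg0 (C := 1) (x := fun _ k => rnorm (L (phi k)))
  sum_Lphi).
  by move=> r r0; case: (errorA (infinite_rank_sigma r0)).
by move=> r k _ _; rewrite mul1r lexx rnorm_ge0.
Qed.

Lemma errorB_cvg0 C : (forall r, (0 < r)%N -> opnorm_le (PiY r) C) ->
  (sum_sqr_L2norm mu (residualB L w PiY r) @[r --> \oo] --> 0)%E.
Proof.
move=> PC; apply: (weighted_tail_cvg0 (C := 1 + C)
  (x := fun r k => rnorm (L (phi k) - PiY r (L (phi k)))) sum_Lphi).
  by move=> r r0; case: (errorB r0 (infinite_rank_sigma r0)).
move=> r k r0 _; rewrite rnorm_ge0/= (le_trans (rnormB _ _))//.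
by rewrite mulrDl mul1r lerD// PC.
Qed.

(** Here [phi_k = L^-1 L phi_k], so the terms are bounded by multiples of
    [|L phi_k|]. *)
Lemma errorC_cvg0 C : invertible L -> bounded_inverse L ->
  (forall r, (0 < r)%N -> opnorm_le (PiY r) C) ->
  (sum_sqr_L2norm mu (residualC L w PiY r) @[r --> \oo] --> 0)%E.
Proof.
move=> iL [_ [D LD]] PC; have D0 : 0 <= `|D| by [].
apply: (weighted_tail_cvg0 (C := `|D| * (1 + C))
  (x := fun r k => rnorm (phi k - linop_inv L (PiY r (L (phi k))))) sum_Lphi).
  by move=> r r0; case: (errorC r0 (infinite_rank_sigma r0) iL).
move=> r k r0 rk; rewrite rnorm_ge0/=.
have dk := phi_dom hLw hsvd (leq_trans r0 (ltnW rk))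
  (infinite_rank_sigma (leq_trans r0 (ltnW rk))).
have leD y : rnorm (linop_inv L y) <= `|D| * rnorm y.
  by rewrite (le_trans (LD y))// ler_wpM2r ?rnorm_ge0 ?ler_norm.
rewrite -{1}(linop_invK iL dk)
  (le_trans (rnormB _ _))// -mulrA mulrDl mul1r mulrDr.
by rewrite lerD// (le_trans (leD _))// ler_wpM2l// PC.
Qed.

Lemma errorC_cvg0_ext C (A : nat -> {linear X -> X}) : invertible L ->
  (forall r, (0 < r)%N -> opnorm_le (A r) C /\
    forall x, dom L x -> A r x = linop_inv L (PiY r (L x))) ->
  (sum_sqr_L2norm mu (residualC L w PiY r) @[r --> \oo] --> 0)%E.
Proof.
move=> iL hA; apply: (weighted_tail_cvg0 (C := 1 + C)
  (x := fun r k => rnorm (phi k - linop_inv L (PiY r (L (phi k))))) sum_phi).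
  by move=> r r0; case: (errorC r0 (infinite_rank_sigma r0) iL).
move=> r k r0 rk; rewrite rnorm_ge0/=.
have k0 := leq_trans r0 (ltnW rk); have [AC AE] := hA r r0.
rewrite -AE; last exact: (phi_dom hLw hsvd k0 (infinite_rank_sigma k0)).
by rewrite (le_trans (rnormB _ _))// mulrDl mul1r lerD// AC.
Qed.

End infinite_rank.

End pod_errors.

Theorem theorem5p4 (R : realType) (s : scalar_kind) (X Y : sep_hilbert R s)
  (L : linop X Y) (d m : nat) (hm : (0 < m)%N)
  (O : set 'rV[R]_d) (oO : open O)
  (w : 'I_m -> euclid R d -> X)
  (hw : forall j, inL2 (lebesgue_on oO) (w j))
  (hLw : pod_standing_assumption (lebesgue_on oO) L w)
  (sigma : nat -> R) (f : nat -> 'I_m -> euclid R d -> scalars R s)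
  (phi : nat -> X) (hsvd : is_svd (lebesgue_on oO) w sigma f phi)
  (PiY : nat -> {linear Y -> Y})
  (hPiY : forall r, (0 < r)%N -> 0 < sigma r ->
    is_bounded_proj (PiY r) (L @` span_upto phi r)) :
  let mu := lebesgue_on oO in
  let errA r := sum_sqr_L2norm mu (residualA L w phi r) in
  let errB r := sum_sqr_L2norm mu (residualB L w PiY r) in
  let errC r := sum_sqr_L2norm mu (residualC L w PiY r) in
  (forall r, (0 < r)%N -> 0 < sigma r ->
    [/\ (forall j, inL2 mu (residualA L w phi r j)) /\
        errA r = (\sum_(r.+1 <= k <oo)
          (sigma k ^+ 2 * rnorm (L (phi k)) ^+ 2)%:E)%E,
        (forall j, inL2 mu (residualB L w PiY r j)) /\
        errB r = (\sum_(r.+1 <= k <oo)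
          (sigma k ^+ 2 * rnorm (L (phi k) - PiY r (L (phi k))) ^+ 2)%:E)%E &
        invertible L ->
        finite_rank mu w \/ commutation_assumption mu L w PiY r ->
        (forall j, inL2 mu (residualC L w PiY r j)) /\
        errC r = (\sum_(r.+1 <= k <oo)
          (sigma k ^+ 2 *
           rnorm (phi k - linop_inv L (PiY r (L (phi k)))) ^+ 2)%:E)%E]) /\
  (~ finite_rank mu w ->
    let unif_bounded_PiY :=
      exists C, forall r, (0 < r)%N -> opnorm_le (PiY r) C in
    let assumptions_C := invertible L /\
      forall r, (0 < r)%N -> commutation_assumption mu L w PiY r in
    let unif_bounded_LPiL := exists (C : R) (A : nat -> {linear X -> X}),
      forall r, (0 < r)%N -> opnorm_le (A r) C /\
        forall x, dom L x -> A r x = linop_inv L (PiY r (L x)) in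
    [/\ errA r @[r --> \oo] --> 0%E,
        unif_bounded_PiY -> errB r @[r --> \oo] --> 0%E,
        assumptions_C -> bounded_inverse L -> unif_bounded_PiY ->
          errC r @[r --> \oo] --> 0%E &
        assumptions_C -> unif_bounded_LPiL -> errC r @[r --> \oo] --> 0%E]).
Proof.
move=> mu errA errB errC; split=> [r r0 sr|infr unifP assC unifA].
  split; first exact: (errorA hw hLw hsvd sr).
    exact: (errorB hw hLw hsvd hPiY r0 sr).
  by move=> iL _; exact: (errorC hw hLw hsvd hPiY r0 sr iL).
split.
- exact: (errorA_cvg0 hw hLw hsvd infr).
- by move=> [C PC]; exact: (errorB_cvg0 hw hLw hsvd hPiY infr PC).
- move=> [iL _] bL [C PC].
  exact: (errorC_cvg0 hw hLw hsvd hPiY infr iL bL PC).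
- move=> [iL _] [C [A hA]].
  exact: (errorC_cvg0_ext hw hLw hsvd hPiY infr iL hA).
Qed.
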